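(* There is a randomized algorithm for the 0-1 knapsack problem that runs in $\widetilde{O}(n^{3/2}p_{\max})$ time and outputs the optimal value $\mathrm{OPT}$ correctly with high probability.
   Context: In the 0-1 knapsack problem, the input is a capacity $W\in\mathbb{Z}^+$ and $n$ items $(w_1,p_1),\dots,(w_n,p_n)$ with weights $w_i\in\mathbb{Z}^+$ and profits $p_i\in\mathbb{Z}^+$. The goal is to compute $\mathrm{OPT}=\max\{\sum_{i\in S}p_i : S\subseteq\{1,\dots,n\},\ \sum_{i\in S}w_i\le W\}$. Here $p_{\max}=\max_i p_i$. The notation $\widetilde{O}(\cdot)$ hides polylogarithmic factors, and ''with high probability'' means with probability at least $1-1/\mathrm{poly}(n)$. *)

(* Defs.v *)
From mathcomp Require Import all_boot.
Set Implicit Arguments. Unset Strict Implicit. Unset Printing Implicit Defensive.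

Definition item_w (items : seq (nat * nat)) (i : nat) : nat := (nth (0, 0) items i).1.
Definition item_p (items : seq (nat * nat)) (i : nat) : nat := (nth (0, 0) items i).2.

Definition valid_instance (W : nat) (items : seq (nat * nat)) : Prop :=
  0 < W /\ all (fun x => (0 < x.1) && (0 < x.2)) items.

Definition OPT (W : nat) (items : seq (nat * nat)) : nat :=
  \max_(S : {set 'I_(size items)} | \sum_(i in S) item_w items i <= W)
     \sum_(i in S) item_p items i.

Definition pmax (items : seq (nat * nat)) : nat := \max_(x <- items) x.2.

(* Memory is a nat-indexed array of words.  Every word value written and
   every address used must be < B (the word bound, polynomial in the
   numbers of the input); otherwise the run faults. *)
Inductive instr : Type :=
| IConst of nat & nat
| IAdd of nat & nat & nat
| ISub of nat & nat & nat
| IMul of nat & nat & nat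
| IDiv of nat & nat & nat
| IMod of nat & nat & nat
| ILoad of nat & nat
| IStore of nat & nat
| IJlt of nat & nat & nat
| IJmp of nat
| IRand of nat
| IHalt.

Definition program := seq instr.

Record config := Config { pc : nat; mem : nat -> nat; tape : seq bool }.

Inductive step_result := Fault | Halted of nat | Next of config.

Definition upd (m : nat -> nat) (a v : nat) : nat -> nat :=
  fun x => if x == a then v else m x.

Definition write (B : nat) (c : config) (a v : nat) (t : seq bool) : step_result :=
  if (a < B) && (v < B) then Next (Config (pc c).+1 (upd (mem c) a v) t) else Fault.

Definition step (B : nat) (P : program) (c : config) : step_result :=
  let m := mem c in
  if pc c < size P then
  match nth IHalt P (pc c) with
  | IConst a k => write B c a k (tape c)
  | IAdd a b d => write B c a (m b + m d) (tape c)
  | ISub a b d => write B c a (m b - m d) (tape c)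
  | IMul a b d => write B c a (m b * m d) (tape c)
  | IDiv a b d => write B c a (m b %/ m d) (tape c)
  | IMod a b d => write B c a (m b %% m d) (tape c)
  | ILoad a b => if m b < B then write B c a (m (m b)) (tape c) else Fault
  | IStore a b => write B c (m a) (m b) (tape c)
  | IJlt a b t => Next (Config (if m a < m b then t else (pc c).+1) m (tape c))
  | IJmp t => Next (Config t m (tape c))
  | IRand a => match tape c with
               | [::] => Fault
               | r :: rs => write B c a (nat_of_bool r) rs
               end
  | IHalt => Halted (m 0)
  end
  else Fault.

Fixpoint run (B : nat) (P : program) (fuel : nat) (c : config) : option (nat * nat) :=
  match fuel with
  | 0 => None
  | f.+1 => match step B P c with
            | Fault => None
            | Halted o => Some (o, 1)
            | Next c' => omap (fun r => (r.1, r.2.+1)) (run B P f c')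
            end
  end.

(* Input layout: mem[0] = n, mem[1] = W, mem[2+2i] = w_i, mem[3+2i] = p_i. *)
Definition init_mem (W : nat) (items : seq (nat * nat)) : nat -> nat :=
  fun x => if x == 0 then size items
           else if x == 1 then W
           else if x < 2 + 2 * size items then
             (if odd x then item_p items ((x - 3)./2) else item_w items ((x - 2)./2))
           else 0.

Definition init_config (W : nat) (items : seq (nat * nat)) (r : seq bool) : config :=
  Config 0 (init_mem W items) r.

Definition output (B : nat) (P : program) (T : nat) (W : nat)
  (items : seq (nat * nat)) (r : seq bool) : option nat :=
  omap fst (run B P T (init_config W items r)).

Definition word_bound (c W : nat) (items : seq (nat * nat)) : nat :=
  (2 + W + size items + \sum_(x <- items) x.1 + \sum_(x <- items) x.2) ^ c.

(* Time bound  c * (n^{3/2} * p_max * log^c(n + p_max) + 1),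
   with n^{3/2} rendered as n * (floor(sqrt n) + 1). *)
Definition time_bound (c : nat) (items : seq (nat * nat)) : nat :=
  let n := size items in
  c * (n * (Nat.sqrt n).+1 * pmax items * (trunc_log 2 (n + pmax items)).+1 ^ c + 1).

(* Main.v *)
(* Give every item an independent uniform key below M, a power of two of order
   sqrt n, and add the items in the order of their keys to the dynamic program
   f[p] = least weight of a set of profit exactly p.  Let S be a feasible set of
   profit about V.  By a Chernoff bound, the items of S with key below k have
   total profit V k / M up to D = O(sqrt n * pmax * log (n pmax)), for all k at
   once, so that f need be updated only in a window of width V / M + 2 D around
   V k / M: this costs O~(sqrt n * pmax) per item.  No stale entry of f ever
   describes an infeasible set, so errors are one-sided.

   If OPT >= V, then some feasible set has profit in [V, V + pmax], and a run with
   target V finds profit V at least; hence a binary search on V, with the same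
   keys throughout, reaches OPT.  The exponential tail leaves room for a union
   bound over all V <= OPT and all k. *)

Require Import Defs.
From mathcomp Require Import all_boot.
From mathcomp Require Import all_order all_algebra Rstruct.
From mathcomp Require Import zify ring lra.

Set Implicit Arguments. Unset Strict Implicit. Unset Printing Implicit Defensive.

(** * A structured language over the machine *)

(** A key is read off log M fair bits, so it is exactly uniform because M is a power of two.
    Independence of the keys makes exponential moments factor over the items, which a random
    permutation would not give. M is the least power of two with n <= M^2. This balances the two
    parts of a window, V / M with V of order n pmax and D of order M pmax log, and it keeps the M
    scans of all n items, one scan per bucket, within n^(3/2).

    The targets V tried by the search depend on the keys through the earlier rounds. So the good
    event covers all V at once, and for each V the tail bound is applied to one set picked from the
    instance alone.

    Windows never depend on what the keys select, and every item lies in exactly one bucket, so the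
    time bound holds on every tape; a bad tape can only give too small an answer. *)

Inductive cmd : Type :=
| Prim of instr
| Seq of cmd & cmd
| While of nat & nat & cmd
| If of nat & nat & cmd.

Coercion Prim : instr >-> cmd.
Notation "a ;; b" := (Seq a b) (at level 60, right associativity).

(** Jump targets are absolute, hence the start address [pos]. The only conditional instruction jumps
    when its test holds, so it skips an unconditional jump to the exit. *)
Fixpoint code (pos : nat) (c : cmd) : program :=
  match c with
  | Prim i => [:: i]
  | Seq c1 c2 => let p1 := code pos c1 in p1 ++ code (pos + size p1) c2
  | While a b c =>
      let p := code (pos + 2) c in
      [:: IJlt a b (pos + 2), IJmp (pos + size p + 3) & rcons p (IJmp pos)]
  | If a b c =>
      let p := code (pos + 2) c in
      [:: IJlt a b (pos + 2), IJmp (pos + size p + 2) & p]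
  end.

Fixpoint block (s : seq instr) (c : cmd) : cmd :=
  if s is i :: s' then Seq i (block s' c) else c.

(** * Total-correctness rules with step counts *)

Section Machine.

Variable B : nat.

Fixpoint reach (P : program) (k : nat) (c c' : config) : Prop :=
  if k is k'.+1 then exists2 c1, step B P c = Next c1 & reach P k' c1 c'
  else c = c'.

Lemma reach_cat P k1 k2 c1 c2 c3 :
  reach P k1 c1 c2 -> reach P k2 c2 c3 -> reach P (k1 + k2) c1 c3.
Proof.
elim: k1 c1 => [|k1 IH] c1 /=; first by move=> ->.
by case=> c st r1 r2; exists c => //; exact: IH r1 r2.
Qed.

Lemma run_reach P k c c' o fuel :
  reach P k c c' -> step B P c' = Halted o -> k < fuel ->
  run B P fuel c = Some (o, k.+1).
Proof.
elim: k c fuel => [|k IH] c [|fuel] //=; first by move=> -> ->.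
by case=> c1 -> r1 h lt; rewrite (IH _ _ r1 h lt).
Qed.

Definition embedded (P : program) (pos : nat) (p : program) : Prop :=
  exists2 pq : program * program, P = pq.1 ++ p ++ pq.2 & size pq.1 = pos.

Lemma embedded_catl P pos p1 p2 :
  embedded P pos (p1 ++ p2) -> embedded P pos p1.
Proof. by case=> [[p q] /= -> <-]; exists (p, p2 ++ q); rewrite //= -catA. Qed.

Lemma embedded_catr P pos p1 p2 :
  embedded P pos (p1 ++ p2) -> embedded P (pos + size p1) p2.
Proof.
case=> [[p q] /= -> <-]; exists (p ++ p1, q).
by rewrite /= -!catA.
by rewrite /= size_cat.
Qed.

Lemma embedded_head P pos i p :
  embedded P pos (i :: p) -> pos < size P /\ nth IHalt P pos = i.
Proof.
case=> [[l r] /= -> <-]; rewrite nth_cat ltnn subnn !size_cat /=; split=> //.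
by lia.
Qed.

Lemma embedded_behead P pos i p :
  embedded P pos (i :: p) -> embedded P pos.+1 p.
Proof. by rewrite -cat1s => /embedded_catr; rewrite addn1. Qed.

(** A termination statement: [Q] also receives the exact number of steps. Quantifying over the
    surrounding program and the position makes fragments composable in spite of absolute jumps. *)
Definition wp (c : cmd) (Q : (nat -> nat) -> seq bool -> nat -> Prop)
    (m : nat -> nat) (t : seq bool) : Prop :=
  forall P pos, embedded P pos (code pos c) ->
  exists m' t' k, reach P k (Config pos m t)
    (Config (pos + size (code pos c)) m' t') /\ Q m' t' k.

Lemma run_wp c Q m t fuel :
  wp c Q m t -> (forall m' t' k, Q m' t' k -> k < fuel) ->
  exists m' t' k, Q m' t' k /\
    run B (code 0 c ++ [:: IHalt]) fuel (Config 0 m t) = Some (m' 0, k.+1).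
Proof.
move=> w lt; set P := _ ++ _.
have [|m' [t' [k [r q]]]] := w P 0; first by exists ([::], [:: IHalt]).
exists m', t', k; split=> //; apply: run_reach r _ (lt _ _ _ q).
by rewrite /step add0n /P /= size_cat addn1 ltnSn nth_cat ltnn subnn.
Qed.

Lemma wp_mono c (Q Q' : (nat -> nat) -> seq bool -> nat -> Prop) m t :
  wp c Q m t -> (forall m' t' k, Q m' t' k -> Q' m' t' k) -> wp c Q' m t.
Proof.
move=> w h P pos e; have [m' [t' [k [r q]]]] := w P pos e.
by exists m', t', k; split=> //; exact: h.
Qed.

Lemma wp_seq c1 c2 Q m t :
  wp c1 (fun m1 t1 k1 => wp c2 (fun m2 t2 k2 => Q m2 t2 (k1 + k2)) m1 t1) m t ->
  wp (Seq c1 c2) Q m t.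
Proof.
move=> w P pos /= e.
have [m1 [t1 [k1 [r1 w2]]]] := w P pos (embedded_catl e).
have [m2 [t2 [k2 [r2 q]]]] := w2 _ _ (embedded_catr e).
exists m2, t2, (k1 + k2); split=> //.
by rewrite size_cat addnA; exact: reach_cat r1 r2.
Qed.

Lemma wp_if a b c Q m t :
  (m a < m b -> wp c (fun m' t' k => Q m' t' k.+1) m t) ->
  (m b <= m a -> Q m t 2) -> wp (If a b c) Q m t.
Proof.
move=> w1 w2 P pos /= e.
have [lt0 n0] := embedded_head e; have e1 := embedded_behead e.
have [lt1 n1] := embedded_head e1; have e2 := embedded_behead e1.
case: (ltnP (m a) (m b)) => [lt|ge].
  rewrite -addn2 in e2; have [m' [t' [k [r q]]]] := w1 lt _ _ e2.
  exists m', t', k.+1; split=> //.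
  exists (Config (pos + 2) m t); first by rewrite /step /= lt0 n0 lt.
  by rewrite !addnS -!addSn in r *; rewrite addn0 in r *.
exists m, t, 2; split; last exact: w2.
exists (Config pos.+1 m t); first by rewrite /step /= lt0 n0 ltnNge ge.
exists (Config (pos + (size (code (pos + 2) c)).+2) m t) => //.
by rewrite /step /= lt1 n1 !addnS addn0.
Qed.

Lemma wp_while a b c (N : nat) (cost : nat -> nat)
    (I : nat -> (nat -> nat) -> seq bool -> Prop)
    (Q : (nat -> nat) -> seq bool -> nat -> Prop) m t :
  I 0 m t ->
  (forall j m t, j < N -> I j m t -> m a < m b /\
     wp c (fun m' t' k => I j.+1 m' t' /\ k <= cost j) m t) ->
  (forall m t, I N m t -> m b <= m a) ->
  (forall m t k, I N m t -> k <= \sum_(j < N) (cost j + 2) + 2 -> Q m t k) ->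
  wp (While a b c) Q m t.
Proof.
move=> I0 body ex post P pos /= e.
have [lt0 n0] := embedded_head e; have e1 := embedded_behead e.
have [lt1 n1] := embedded_head e1; have e2 := embedded_behead e1.
rewrite -addn2 -cats1 in e2; set p := code _ _ in e2 n1 *.
have [lt3 n3] := embedded_head (embedded_catr e2).
have e3 := embedded_catl e2.
suff main d j m0 t0 : d + j = N -> I j m0 t0 -> exists m' t' k,
    [/\ reach P k (Config pos m0 t0) (Config (pos + (size p + 3)) m' t'),
        I N m' t' & k <= \sum_(j <= i < N) (cost i + 2) + 2].
  have [m' [t' [k [r i le]]]] := main N 0 m t (addn0 N) I0.
  exists m', t', k; split; first by rewrite size_rcons -addn3.
  by apply: post => //; rewrite -(big_mkord predT (fun i => cost i + 2)).
elim: d j m0 t0 => [|d IH] j m0 t0 dj Ij.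
  rewrite add0n in dj; rewrite dj in Ij.
  have ge := ex _ _ Ij; exists m0, t0, 2; split=> //; last by rewrite leq_addl.
  exists (Config pos.+1 m0 t0); first by rewrite /step /= lt0 n0 ltnNge ge.
  exists (Config (pos + (size p + 3)) m0 t0) => //.
  by rewrite /step /= lt1 n1 !addnA.
have ltj : j < N by lia.
have [lt w] := body _ _ _ ltj Ij.
have [m1 [t1 [k1 [r1 [I1 le1]]]]] := w _ _ e3.
have [|m2 [t2 [k2 [r2 I2 le2]]]] := IH j.+1 m1 t1 _ I1; first by lia.
exists m2, t2, (1 + (k1 + (1 + k2))); split=> //.
  apply: (@reach_cat _ 1 _ _ (Config (pos + 2) m0 t0)).
    by exists (Config (pos + 2) m0 t0); rewrite // /step /= lt0 n0 lt.
  apply: reach_cat r1 _; apply: (@reach_cat _ 1 _ _ (Config pos m1 t1)) r2.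
  by exists (Config pos m1 t1); rewrite // /step /= lt3 n3.
by rewrite big_ltn //; lia.
Qed.

Hypothesis B64 : 64 <= B.

Lemma wp_write (i : instr) a v t' Q m t :
  (forall P pos, pos < size P -> nth IHalt P pos = i ->
     step B P (Config pos m t) = write B (Config pos m t) a v t') ->
  a < B -> v < B -> Q (upd m a v) t' 1 -> wp i Q m t.
Proof.
move=> st ltA ltv q P pos /= e; have [lt n] := embedded_head e.
exists (upd m a v), t', 1; split=> //.
by exists (Config pos.+1 (upd m a v) t'); rewrite ?st /write ?ltA ?ltv ?addn1.
Qed.

(** The written value is passed as a fresh name with an equation, so that symbolic execution does
    not nest ever larger terms in the memory. *)
Lemma wp_alu (i : instr) a v Q m t :
  (forall P pos, pos < size P -> nth IHalt P pos = i ->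
     step B P (Config pos m t) = write B (Config pos m t) a v t) ->
  a < 64 -> (forall v', v' = v -> v' < B /\ Q (upd m a v') t 1) -> wp i Q m t.
Proof.
move=> st aB h; have [//|lt q] := h v.
by apply: wp_write st _ lt q; exact: leq_trans B64.
Qed.

Lemma wp_const a k Q m t : a < 64 ->
  (forall v, v = k -> v < B /\ Q (upd m a v) t 1) -> wp (IConst a k) Q m t.
Proof. by apply: wp_alu => P pos lt n; rewrite /step lt n. Qed.

Lemma wp_add a b d Q m t : a < 64 ->
  (forall v, v = m b + m d -> v < B /\ Q (upd m a v) t 1) ->
  wp (IAdd a b d) Q m t.
Proof. by apply: wp_alu => P pos lt n; rewrite /step lt n. Qed.

Lemma wp_sub a b d Q m t : a < 64 ->
  (forall v, v = m b - m d -> v < B /\ Q (upd m a v) t 1) ->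
  wp (ISub a b d) Q m t.
Proof. by apply: wp_alu => P pos lt n; rewrite /step lt n. Qed.

Lemma wp_mul a b d Q m t : a < 64 ->
  (forall v, v = m b * m d -> v < B /\ Q (upd m a v) t 1) ->
  wp (IMul a b d) Q m t.
Proof. by apply: wp_alu => P pos lt n; rewrite /step lt n. Qed.

Lemma wp_div a b d Q m t : a < 64 ->
  (forall v, v = m b %/ m d -> v < B /\ Q (upd m a v) t 1) ->
  wp (IDiv a b d) Q m t.
Proof. by apply: wp_alu => P pos lt n; rewrite /step lt n. Qed.

Lemma wp_load a b Q m t : a < 64 -> m b < B ->
  (forall v, v = m (m b) -> v < B /\ Q (upd m a v) t 1) ->
  wp (ILoad a b) Q m t.
Proof.
move=> aB bB; apply: wp_alu aB => P pos lt n.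
by rewrite /step lt n /= bB.
Qed.

Lemma wp_store a b Q m t :
  m a < B -> m b < B -> Q (upd m (m a) (m b)) t 1 -> wp (IStore a b) Q m t.
Proof.
move=> aB bB; apply: wp_write => // P pos lt n; by rewrite /step lt n.
Qed.

Lemma wp_rand a b Q m t : a < 64 ->
  (forall v, v = nat_of_bool b -> Q (upd m a v) t 1) ->
  wp (IRand a) Q m (b :: t).
Proof.
move=> aB q; apply: (@wp_write _ a (nat_of_bool b) t).
- by move=> P pos lt n; rewrite /step lt n.
- exact: leq_trans B64.
- by apply: leq_trans B64; case: (b).
- exact: q.
Qed.

End Machine.

(** * The dynamic program *)

Section Dp.

Variables (W : nat) (items : seq (nat * nat)).
Notation n := (size items).
Implicit Types (S proc : {set 'I_n}) (key : nat -> nat).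

Definition wsum S := \sum_(i in S) item_w items i.
Definition psum S := \sum_(i in S) item_p items i.

Lemma psum_le_OPT S : wsum S <= W -> psum S <= OPT W items.
Proof. exact: (@leq_bigmax_cond _ (fun S => wsum S <= W) psum). Qed.

Lemma psum_subset S S' : S \subset S' -> psum S <= psum S'.
Proof.
move=> sub; rewrite /psum [leqRHS](big_setID S) /= (setIidPr sub).
exact: leq_addr.
Qed.

Lemma item_p_le_pmax i : item_p items i <= pmax items.
Proof.
rewrite /item_p /pmax; case: (ltnP i n) => [lt|ge]; last by rewrite nth_default.
by rewrite (big_nth (0, 0)) big_mkord (leq_bigmax (Ordinal lt)).
Qed.

Lemma psum_le S : psum S <= n * pmax items.
Proof.
apply: leq_trans (_ : #|S| * pmax items <= _); last first.
  by rewrite leq_mul2r -[leqRHS]card_ord max_card orbT.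
rewrite -sum_nat_const; apply: leq_sum => i _; exact: item_p_le_pmax.
Qed.

Lemma OPT_le : OPT W items <= n * pmax items.
Proof. by apply/bigmax_leqP => S _; exact: psum_le. Qed.

(* The items that the program handles before item i of bucket k. *)
Definition proc_set (key : nat -> nat) (k i : nat) : {set 'I_n} :=
  [set j : 'I_n | (key j < k) || (key j == k) && (j < i)].

(** The two bounds are tested at opposite ends of bucket [k], the lower one before it and the upper
    one after it. Partial profits only grow, so every stage inside the bucket lies between them, in
    whatever order its items come. *)
Definition fits (key lo hi : nat -> nat) (K : nat) S : Prop :=
  forall k, k < K -> lo k <= psum (S :&: proc_set key k 0) /\
                     psum (S :&: proc_set key k.+1 0) <= hi k.

(** [W.+1] plays infinity: an entry is live when it is at most [W]. Soundness holds for all entries,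
    inside and outside the windows; completeness is claimed only along the target sets. [b0] is the
    best profit from earlier rounds. *)
Record dp_inv (target : {set 'I_n} -> Prop) (b0 size : nat) proc
    (f : nat -> nat) (b : nat) : Prop := DpInv {
  dp_bound : forall p, p < size -> f p <= W.+1;
  dp_sound : forall p, p < size -> f p <= W ->
    exists S, [/\ S \subset proc, psum S = p & wsum S = f p];
  dp_best : forall p, 0 < p < size -> f p <= W -> p <= b;
  dp_best_ge : b0 <= b;
  dp_best_opt : b <= OPT W items;
  dp_complete : forall S, target S ->
    f (psum (S :&: proc)) <= wsum (S :&: proc) }.

Lemma eq_dp_inv target b0 size proc f f' b : f =1 f' ->
  dp_inv target b0 size proc f b -> dp_inv target b0 size proc f' b.
Proof.
move=> ff [h1 h2 h3 h4 h5 h6]; split=> // [p lt|p lt|p lt|S tS]; rewrite -ff.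
- exact: h1.
- exact: h2.
- exact: h3.
- exact: h6.
Qed.

Lemma dp_inv_init target size f b : 0 < size ->
  f 0 = 0 -> (forall p, 0 < p < size -> f p = W.+1) -> b <= OPT W items ->
  dp_inv target b size set0 f b.
Proof.
move=> size0 f0 fW bo; split=> //.
- by case=> [|p] lt; rewrite ?f0 // fW.
- case=> [|p] lt; last by rewrite fW ?ltnn.
  by exists set0; rewrite sub0set /psum /wsum !big_set0 f0.
- by move=> p lt; rewrite fW ?ltnn.
- by move=> S _; rewrite setI0 /psum /wsum !big_set0 f0.
Qed.

Definition improves (f : nat -> nat) (l h w p q : nat) : bool :=
  (l <= q <= h) && (f (q - p) + w < f q).

(** A replaced entry was at most [W.+1] and its replacement is strictly smaller, so whatever is
    written describes a feasible set and infinity never spreads. Raising the lower end to [p] keeps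
    [q - p] from being truncated. A target without [i] survives because entries only decrease, a
    target with [i] because its new profit lies in the window. *)
Lemma dp_inv_item (target : {set 'I_n} -> Prop) b0 size proc f b f' b'
    (i : 'I_n) lo hi :
  let w := item_w items i in let p := item_p items i in
  let l := maxn lo p in
  dp_inv target b0 size proc f b -> i \notin proc -> hi < size ->
  (forall S, psum S < size) ->
  (forall S, target S -> i \in S -> lo <= psum (S :&: (i |: proc)) <= hi) ->
  (forall q, q < size ->
     f' q = if improves f l hi w p q then f (q - p) + w else f q) ->
  b <= b' -> (forall q, improves f l hi w p q -> q <= b') ->
  (b' = b \/ improves f l hi w p b') ->
  dp_inv target b0 size (i |: proc) f' b'.
Proof.
move=> w p l [bnd snd bst b0b opt cmp] nproc hisz psz win f'E bb' imp b'E.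
have wU S : i \notin S -> wsum (i |: S) = w + wsum S by move=> h; rewrite /wsum big_setU1.
have pU S : i \notin S -> psum (i |: S) = p + psum S by move=> h; rewrite /psum big_setU1.
have le' q : q < size -> f' q <= f q.
  by move=> lt; rewrite f'E //; case: ifP => // /andP[_ /ltnW].
have new q : improves f l hi w p q -> exists S,
    [/\ S \subset i |: proc, psum S = q, wsum S = f (q - p) + w &
     wsum S <= W].
  case/andP=> /andP[lq qh] lt.
  have ltsz : q - p < size by lia.
  have fqW : f q <= W.+1 by apply: bnd; lia.
  have [|S [sub pS wS]] := snd _ ltsz; first by lia.
  have iS : i \notin S by apply: contra nproc; exact: (subsetP sub).
  exists (i |: S); rewrite wU // pU // pS wS; split=> //; try lia.
  exact: setUS.
split.
- by move=> q lt; apply: leq_trans (le' q lt) (bnd q lt).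
- move=> q lt; rewrite f'E //; case: ifP => [/new[S [sub pS wS _]] _|_ leW].
    by exists S.
  have [S [sub pS wS]] := snd q lt leW; exists S; split=> //.
  exact: subset_trans sub (subsetUr _ _).
- move=> q /andP[q0 lt]; rewrite f'E //; case: ifP => [/imp //|_ leW].
  by apply: leq_trans bb'; apply: bst; rewrite ?q0.
- exact: leq_trans bb'.
- case: b'E => [->//|/new[S [_ <- _ leW]]]; exact: psum_le_OPT.
- move=> S tS; case: (boolP (i \in S)) => iS; last first.
    have -> : S :&: (i |: proc) = S :&: proc.
      by apply/setP=> j; rewrite !inE; case: eqP => [->|]; rewrite ?(negbTE iS).
    exact: leq_trans (le' _ (psz _)) (cmp S tS).
  have E : S :&: (i |: proc) = i |: (S :&: proc).
    by apply/setP=> j; rewrite !inE; case: eqP => [->|]; rewrite ?iS.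
  have iSp : i \notin S :&: proc by rewrite inE negb_and nproc orbT.
  have := win S tS iS; rewrite E wU // pU //; set P := psum _ => /andP[loP Phi].
  have fP : f P <= wsum (S :&: proc) := cmp S tS.
  rewrite f'E; last by lia.
  rewrite /improves /l addKn.
  have -> : maxn lo p <= p + P <= hi by lia.
  by case: ltnP => /=; lia.
Qed.

Lemma proc_set_start key : proc_set key 0 0 = set0.
Proof. by apply/setP=> j; rewrite !inE ltn0 andbF. Qed.

Lemma proc_set_bucket key k : proc_set key k n = proc_set key k.+1 0.
Proof.
by apply/setP=> j; rewrite !inE ltn_ord andbT andbF orbF ltnS [RHS]leq_eqVlt orbC.
Qed.

Lemma proc_set_end key K : (forall i, i < n -> key i < K) ->
  proc_set key K 0 = setT.
Proof. by move=> h; apply/setP=> j; rewrite !inE h. Qed.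

Lemma proc_set_skip key k (i : 'I_n) : key i != k ->
  proc_set key k i.+1 = proc_set key k i.
Proof.
move=> ne; apply/setP=> j; rewrite !inE ltnS [j <= i]leq_eqVlt.
by case: (eqVneq (j : nat) i) => [->|] //=; rewrite (negbTE ne).
Qed.

Lemma proc_set_take key k (i : 'I_n) : key i = k ->
  proc_set key k i.+1 = i |: proc_set key k i.
Proof.
move=> E; apply/setP=> j; rewrite !inE ltnS [j <= i]leq_eqVlt.
case: (eqVneq j i) => [->|ne]; first by rewrite E !eqxx orbT.
by rewrite val_eqE (negbTE ne).
Qed.

Lemma proc_set_notin key k (i : 'I_n) : key i = k -> i \notin proc_set key k i.
Proof. by move=> E; rewrite inE E !ltnn andbF. Qed.

Lemma fits_window key lo hi K S k (i : 'I_n) :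
  fits key lo hi K S -> k < K -> key i = k ->
  lo k <= psum (S :&: (i |: proc_set key k i)) <= hi k.
Proof.
move=> fS ltk E; rewrite -proc_set_take //; have [lS Sh] := fS k ltk.
apply/andP; split.
  apply: leq_trans lS (psum_subset _); apply: setIS; apply/subsetP=> j.
  by rewrite !inE andbF orbF => ->.
apply: leq_trans (psum_subset _) Sh; apply: setIS; apply/subsetP=> j.
by rewrite !inE andbF orbF => /orP[|/andP[/eqP-> _]] //; exact: leqW.
Qed.

Lemma dp_inv_final target b0 size f b S V :
  dp_inv target b0 size setT f b -> (forall S, psum S < size) ->
  target S -> wsum S <= W -> 0 < V <= psum S -> V <= b.
Proof.
move=> [_ _ bst _ _ cmp] psz tS wS /andP[V0 VS].
have := cmp S tS; rewrite setIT => fS; apply: (leq_trans VS); apply: bst.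
  by rewrite psz andbT (leq_trans V0 VS).
exact: leq_trans fS wS.
Qed.

(* Removing items one by one from an optimal solution overshoots V by less than pmax. *)
Lemma exists_near_subset V : V <= OPT W items ->
  exists S, [/\ wsum S <= W, V <= psum S & psum S <= V + pmax items].
Proof.
move=> leV; have [S0 [wS0 pS0]] : exists S, wsum S <= W /\ V <= psum S.
  have w0 : wsum set0 <= W by rewrite /wsum big_set0.
  have [|S wS E] := @eq_bigmax_cond _ (fun S => wsum S <= W) psum.
    by apply/card_gt0P; exists set0.
  by exists S; rewrite -E.
(* Successive removal becomes a choice of least cardinality among the feasible sets of profit at
   least [V]: dropping any item must bring the profit below [V]. *)
have := @arg_minnP _ S0 (fun S => (wsum S <= W) && (V <= psum S)) (fun S => #|S|).
rewrite wS0 pS0 => /(_ isT)[S /andP[wS pS] minS].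
exists S; split=> //; rewrite leqNgt; apply/negP=> lt.
have [i iS] : exists i, i \in S.
  apply/set0Pn/eqP=> E; move: lt; rewrite E /psum big_set0; lia.
have pi := item_p_le_pmax i.
have pE : psum S = item_p items i + psum (S :\ i) by rewrite /psum (big_setD1 i).
have wE : wsum S = item_w items i + wsum (S :\ i) by rewrite /wsum (big_setD1 i).
have := minS (S :\ i); rewrite [#|S|](cardsD1 i) iS; lia.
Qed.

End Dp.

(** * Random keys and concentration *)

(** Horner evaluation, most significant bit first, exactly as the machine accumulates a key. *)
Definition bits (acc : nat) (u : seq bool) : nat :=
  foldl (fun k b => k + k + nat_of_bool b) acc u.

Definition tape_key (m : nat) (t : seq bool) (i : nat) : nat :=
  bits 0 (take m (drop (m * i) t)).

Section Concentration.
Import Order.TTheory GRing.Theory Num.Theory.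
Local Open Scope ring_scope.

(* All that is used of the exponential function. *)
Variables (R : realFieldType) (expR : R -> R).
Hypotheses (expRD : forall x y, expR (x + y) = expR x * expR y)
  (expR_ge1Dx : forall x, 1 + x <= expR x).
Implicit Types f g : seq bool -> R.

(** An unnormalised expectation over uniform bit strings. Recursion on plain sequences lets a tape
    be cut into blocks without casts between tuple lengths. *)
Fixpoint tape_sum (N : nat) (f : seq bool -> R) : R :=
  if N is N'.+1 then
    tape_sum N' (fun u => f (true :: u)) + tape_sum N' (fun u => f (false :: u))
  else f [::].

Lemma eq_tape_sum N (f g : seq bool -> R) :
  (forall u, size u = N -> f u = g u) -> tape_sum N f = tape_sum N g.
Proof.
elim: N f g => [|N IH] f g fg /=; first exact: fg.
by congr (_ + _); apply: IH => u su; apply: fg; rewrite /= su.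
Qed.

Lemma tape_sumZ N c f : tape_sum N (fun u => c * f u) = c * tape_sum N f.
Proof. by elim: N f => [|N IH] f //=; rewrite !IH mulrDr. Qed.

Lemma tape_sum_const N c : tape_sum N (fun=> c) = 2 ^+ N * c.
Proof.
elim: N => [|N IH] /=; first by rewrite expr0 mul1r.
by rewrite IH exprS; ring.
Qed.

Lemma tape_sum_cat a b f :
  tape_sum (a + b) f = tape_sum a (fun u => tape_sum b (fun v => f (u ++ v))).
Proof. by elim: a f => [|a IH] f //=; rewrite !IH. Qed.

Lemma tape_sum_tuple N f : \sum_(r : N.-tuple bool) f r = tape_sum N f.
Proof.
elim: N f => [|N IH] f /=.
  rewrite (eq_bigr (fun=> f [::])) => [|r _]; last by rewrite tuple0.
  by rewrite sumr_const card_tuple.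
rewrite -!IH; pose h (p : bool * N.-tuple bool) := [tuple of p.1 :: p.2].
rewrite (reindex h) /=; last first.
  exists (fun t : N.+1.-tuple bool => (thead t, [tuple of behead t])) => [[b t] _|t _].
    by congr pair; apply: val_inj.
  by rewrite /h /= [RHS]tuple_eta.
by rewrite -(pair_big predT predT (fun b (t : N.-tuple bool) => f (b :: t))) /= big_bool.
Qed.

(** Uniformity of a key: the [m]-bit strings enumerate each of the [2 ^ m] values once. *)
Lemma tape_sum_bits m acc (g : nat -> R) :
  tape_sum m (fun u => g (bits acc u)) = \sum_(x < 2 ^ m) g (acc * 2 ^ m + x)%N.
Proof.
elim: m acc => [|m IH] acc /=.
  by rewrite expn0 big_ord1 muln1 addn0.
have -> : (2 ^ m.+1 = 2 ^ m + 2 ^ m)%N by rewrite expnS; lia.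
rewrite big_split_ord /= addrC !IH; congr (_ + _); apply: eq_bigr => x _; congr g; nia.
Qed.

Lemma tape_key0 m u v : size u = m -> tape_key m (u ++ v) 0 = bits 0 u.
Proof. by move=> su; rewrite /tape_key muln0 drop0 take_size_cat. Qed.

Lemma tape_keyS m u v i : size u = m -> tape_key m (u ++ v) i.+1 = tape_key m v i.
Proof. by move=> su; rewrite /tape_key mulnS addnC -drop_drop drop_size_cat. Qed.

(** Independence of the keys: they use disjoint blocks of the tape, so the expectation of a product
    is the product of the expectations; unread bits contribute [2 ^+ rest]. *)
Lemma tape_sum_keys m n rest (g : nat -> nat -> R) :
  tape_sum (m * n + rest) (fun t => \prod_(i < n) g i (tape_key m t i)) =
  2 ^+ rest * \prod_(i < n) \sum_(x < 2 ^ m) g i x.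
Proof.
elim: n g => [|n IH] g.
  rewrite muln0 add0n big_ord0 -tape_sum_const; apply: eq_tape_sum => u _.
  by rewrite big_ord0.
rewrite mulnS -addnA tape_sum_cat big_ord_recl /=.
rewrite (eq_tape_sum (g := fun u =>
  (2 ^+ rest * \prod_(i < n) \sum_(x < 2 ^ m) g i.+1 x) * g 0%N (bits 0 u))) => [|u su].
  by rewrite tape_sumZ tape_sum_bits mulrAC mulrA.
rewrite -(IH (fun i => g i.+1)) mulrC -tape_sumZ; apply: eq_tape_sum => v _.
rewrite big_ord_recl tape_key0 //; congr (_ * _).
by apply: eq_bigr => i _; rewrite tape_keyS.
Qed.

Let expR0 : expR 0 = 1.
Proof.
have e1 : 1 <= expR 0 by have := expR_ge1Dx 0; rewrite addr0.
have e0 : expR 0 != 0 by rewrite lt0r_neq0 // (lt_le_trans ltr01).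
by apply: (mulfI e0); rewrite -expRD addr0 mulr1.
Qed.

Let expRN x : expR (- x) = (expR x)^-1.
Proof. by apply: divr1_eq; rewrite invrK -expRD addNr expR0. Qed.

Let expR_gt0 x : 0 < expR x.
Proof.
rewrite lt0r; apply/andP; split.
  apply/eqP=> e; have := expRD x (- x).
  by rewrite e mul0r subrr expR0 => /eqP; rewrite oner_eq0.
by rewrite (_ : x = x / 2 + x / 2) ?expRD ?sqr_ge0 //; field.
Qed.

Let expR_ge0 x : 0 <= expR x. Proof. exact: ltW. Qed.

Let ler_expR x y : x <= y -> expR x <= expR y.
Proof.
move=> xy; rewrite -(subrK x y) expRD ler_peMl //.
by apply: le_trans (expR_ge1Dx _); rewrite lerDl subr_ge0.
Qed.

Let expRM_natl k x : expR (k%:R * x) = expR x ^+ k.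
Proof.
elim: k => [|k IH]; first by rewrite mul0r expR0.
by rewrite -natr1 mulrDl mul1r expRD IH exprSr.
Qed.

(** Apply [1 + y <= expR y] at [y = - x / (1 + x)] and invert to get [expR (x / (1 + x)) <= 1 + x].
    For [x >= -1/2] the exponent [x - 2 x^2] is at most [x / (1 + x)]. *)
Lemma expR_le_1Dx (x : R) : `|x| <= 2^-1 -> expR (x - 2 * x ^+ 2) <= 1 + x.
Proof.
rewrite ler_norml => /andP[x1 x2]; have x0 : 0 < 1 + x by lra.
have h : 1 - x / (1 + x) <= expR (- (x / (1 + x))) by exact: expR_ge1Dx.
have e : 1 - x / (1 + x) = (1 + x)^-1 by field; lra.
apply: le_trans (_ : expR (x / (1 + x)) <= _); last first.
  rewrite -[leRHS]invrK -[leLHS]invrK lef_pV2 ?posrE ?invr_gt0 ?expR_gt0 //.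
  by rewrite -expRN -[leLHS]e.
apply: ler_expR; rewrite ler_pdivlMr //; nra.
Qed.

(** * Exponential moments of the deviation *)

Section Deviation.
Variables (m n rest pm k : nat) (a : nat -> nat) (eps : R).
Local Notation M := (2 ^ m)%N.
Hypotheses (pm0 : (0 < pm)%N) (kM : (k <= M)%N).
Hypotheses (apm : forall i, (a i <= pm)%N) (epsle : `|eps| <= 2^-1).

Let c i : R := eps * ((a i)%:R / pm%:R).
Let q : R := k%:R / M%:R.
Let Z t : R := \prod_(i < n) (1 + c i * ((tape_key m t i < k)%N%:R - q)).
Let dev t : R := \sum_(i < n) (a i)%:R * ((tape_key m t i < k)%N%:R - q).

Let M0 : 0 < (M%:R : R). Proof. by rewrite ltr0n expn_gt0. Qed.
Let p0 : 0 < (pm%:R : R). Proof. by rewrite ltr0n. Qed.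

Let q01 : 0 <= q <= 1.
Proof.
rewrite /q divr_ge0 ?ler0n //= ler_pdivrMr // mul1r ler_nat //.
Qed.

Let sumZ : \sum_(t : (m * n + rest).-tuple bool) Z t = 2 ^+ (m * n + rest).
Proof.
rewrite tape_sum_tuple (tape_sum_keys m n rest (fun i x => 1 + c i * ((x < k)%N%:R - q))).
rewrite exprD mulrC exprM; congr (_ * _).
have -> : (2 ^+ m ^+ n : R) = \prod_(i < n) 2 ^+ m by rewrite prodr_const card_ord.
apply: eq_bigr => i _.
rewrite big_split /= sumr_const card_ord -mulr_sumr sumrB sumr_const card_ord.
have -> : \sum_(x < M) ((x < k)%N%:R : R) = k%:R.
  rewrite -natr_sum; congr (_%:R).
  rewrite (eq_bigr (fun x : 'I_M => if (x < k)%N then 1%N else 0%N)) => [|x _].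
    by rewrite -big_mkcond -(big_ord_widen M (fun=> 1%N)) // sum1_card card_ord.
  by case: ifP.
rewrite -[q *+ M]mulr_natr /q mulrVK ?unitfE ?lt0r_neq0 // subrr mulr0 addr0.
by rewrite natrX.
Qed.

(* Z is a product of independent factors of mean 1, and 1 + x >= exp (x - 2 x^2)
   makes Z large wherever eps * dev is. *)
Lemma markov_dev E (P : pred (seq bool)) :
  (forall t, P t -> E <= eps / pm%:R * dev t - 2 * eps ^+ 2 * n%:R) ->
  #|[pred t : (m * n + rest).-tuple bool | P t]|%:R * expR E <= 2 ^+ (m * n + rest) :> R.
Proof.
move=> PE; rewrite -sumZ.
have x2 t (i : 'I_n) : `|c i * ((tape_key m t i < k)%N%:R - q)| <= `|eps|.
  rewrite /c -mulrA normrM; apply: ler_piMr => //; rewrite normrM; apply: mulr_ile1 => //.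
    rewrite normrM normfV !ger0_norm ?ler0n // ler_pdivrMr // mul1r ler_nat.
    exact: apm.
  by move: q01; case: (_ < _)%N => /andP[q0 q1]; rewrite ler_norml /=; lra.
have expZ t : expR (eps / pm%:R * dev t - 2 * eps ^+ 2 * n%:R) <= Z t.
  have -> : eps / pm%:R * dev t - 2 * eps ^+ 2 * n%:R =
      \sum_(i < n) (c i * ((tape_key m t i < k)%N%:R - q) - 2 * eps ^+ 2).
    rewrite sumrB sumr_const card_ord mulr_natr; congr (_ - _).
    rewrite mulr_sumr; apply: eq_bigr => i _; rewrite /c; ring.
  rewrite (big_morph expR expRD expR0); apply: ler_prod => i _; rewrite expR_ge0 /=.
  set x := c i * _; apply: le_trans (expR_le_1Dx (le_trans (x2 t i) epsle)).
  apply: ler_expR; rewrite lerD2l lerN2 ler_pM2l // -/x.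
  rewrite -[x ^+ 2]real_normK ?num_real // -[eps ^+ 2]real_normK ?num_real //.
  by apply: lerXn2r; rewrite ?nnegrE ?normr_ge0 //; exact: x2.
rewrite mulr_natl -sumr_const big_mkcond /=; apply: ler_sum => t _.
apply: le_trans (expZ t); rewrite inE; case: ifP => [Pt|_]; last exact: expR_ge0.
by apply: ler_expR; exact: PE.
Qed.

(** Since [expR 1 >= 2], the exponent [3 * L] yields the integer factor [2 ^ (3 * L)], and the bound
    becomes a statement about natural numbers. *)
Lemma markov_dev_nat L (P : pred (seq bool)) :
  (forall t, P t -> (3 * L)%:R <= eps / pm%:R * dev t - 2 * eps ^+ 2 * n%:R) ->
  (#|[pred t : (m * n + rest).-tuple bool | P t]| * 2 ^ (3 * L) <= 2 ^ (m * n + rest))%N.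
Proof.
move=> /markov_dev h; rewrite -(ler_nat R) natrM !natrX; apply: le_trans h.
rewrite ler_wpM2l ?ler0n // -[(3 * L)%:R]mulr1 expRM_natl.
apply: lerXn2r; rewrite ?nnegrE ?expR_ge0 //.
by apply: le_trans (expR_ge1Dx 1); lra.
Qed.

End Deviation.

(** * Upper and lower tail at one threshold *)

Section Window.
Variables (m n rest pm k L : nat) (a : nat -> nat).
Local Notation M := (2 ^ m)%N.
Hypotheses (pm0 : (0 < pm)%N) (kM : (k <= M)%N) (L0 : (0 < L)%N).
Hypotheses (apm : forall i, (a i <= pm)%N) (nM : (n <= M * M)%N).

Let PS t := (\sum_(i < n) if tape_key m t i < k then a i else 0)%N.
Let tot := (\sum_(i < n) a i)%N.
Let D0 := (7 * M * pm * L)%N.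
(* As n <= M^2, this choice keeps the quadratic term 2 eps^2 n below 1/2. *)
Let eps : R := (2 * M%:R)^-1.

Let M0 : 0 < (M%:R : R). Proof. by rewrite ltr0n expn_gt0. Qed.
Let M1 : 1 <= (M%:R : R). Proof. by rewrite ler1n expn_gt0. Qed.
Let p0 : 0 < (pm%:R : R). Proof. by rewrite ltr0n. Qed.

Let epsle : `|eps| <= 2^-1.
Proof.
have m1 := M1; rewrite ger0_norm ?invr_ge0 ?mulr_ge0 ?ler0n // /eps lef_pV2 ?posrE; lra.
Qed.

Let epsn : 2 * eps ^+ 2 * n%:R <= 2^-1.
Proof.
have m1 := M1; have nM' : (n%:R : R) <= M%:R * M%:R by rewrite -natrM ler_nat.
have -> : 2 * eps ^+ 2 * n%:R = n%:R / (2 * (M%:R * M%:R)).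
  by rewrite /eps; field; lra.
by rewrite ler_pdivrMr; nra.
Qed.

Let devE t : M%:R * (\sum_(i < n) (a i)%:R *
    ((tape_key m t i < k)%N%:R - (k%:R / M%:R)) : R) =
  (M * PS t)%:R - (tot * k)%:R.
Proof.
have m1 := M1.
rewrite (eq_bigr (fun i : 'I_n => ((if (tape_key m t i < k)%N then a i else 0)%:R
  - (a i)%:R * (k%:R / M%:R)))) => [|i _]; last first.
  by case: ifP => _; rewrite mulrBr ?mulr1 ?mulr0.
rewrite sumrB -mulr_suml -!natr_sum -/(PS t) -/tot !natrM; field; lra.
Qed.

(** With [eps = 1 / (2 M)] a deviation of [D0] contributes [7 L / 2]. The quadratic term takes away
    at most 1/2, and [L >= 1] leaves [3 L]: this is the origin of the 7 in [D0]. *)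
Let gap (x : R) : M%:R * D0%:R <= M%:R * x ->
  (3 * L)%:R <= eps / pm%:R * x - 2 * eps ^+ 2 * n%:R.
Proof.
have m1 := M1; have p1 := p0; rewrite ler_pM2l // => Dx.
apply: le_trans (_ : eps / pm%:R * D0%:R - 2^-1 <= _); last first.
  by apply: lerB => //; rewrite ler_wpM2l // divr_ge0 ?invr_ge0 ?mulr_ge0 ?ler0n.
have -> : eps / pm%:R * D0%:R = 7 * L%:R / 2.
  by rewrite /eps /D0 !natrM; field; lra.
have L1 : 1 <= (L%:R : R) by rewrite ler1n.
rewrite natrM; lra.
Qed.

Lemma window_above :
  (#|[pred t : (m * n + rest).-tuple bool | tot * k + M * D0 < M * PS t]|
    * 2 ^ (3 * L) <= 2 ^ (m * n + rest))%N.
Proof.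
apply: (@markov_dev_nat m n rest pm k a eps pm0 kM apm epsle L
  (fun t => tot * k + M * D0 < M * PS t)%N) => t lt.
apply: gap; rewrite devE lerBrDl -natrM -natrD ler_nat; exact: ltnW.
Qed.

Lemma window_below :
  (#|[pred t : (m * n + rest).-tuple bool | M * PS t + M * D0 < tot * k]|
    * 2 ^ (3 * L) <= 2 ^ (m * n + rest))%N.
Proof.
have Neps : `|- eps| <= 2^-1 by rewrite normrN.
apply: (@markov_dev_nat m n rest pm k a (- eps) pm0 kM apm Neps L
  (fun t => M * PS t + M * D0 < tot * k)%N) => t lt; rewrite sqrrN mulNr mulNr -mulrN.
apply: gap; rewrite mulrN devE opprB lerBrDl -natrM -natrD ler_nat; exact: ltnW.
Qed.

End Window.
End Concentration.

(** The union bound in counting form. *)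
Lemma card_exists_le (T I : finType) (P : I -> pred T) :
  #|[pred t | [exists i, P i t]]| <= \sum_i #|P i|.
Proof.
have cardE (Q : pred T) : #|Q| = \sum_t nat_of_bool (Q t).
  rewrite -sum1_card big_mkcond; apply: eq_bigr => t _.
  by rewrite unfold_in; case: (Q t).
rewrite cardE (eq_bigr _ (fun i _ => cardE (P i))) exchange_big /=.
apply: leq_sum => t _; case: existsP => // -[i Pi].
by rewrite (bigD1 i) //= Pi.
Qed.

(** Union bound over the families [a j], the thresholds [k] and the two tails, which explains the
    factor on the right. Everything is multiplied by [2 ^ m] to avoid fractions. *)
Lemma concentration (I : finType) (a : I -> nat -> nat) m n N pm L :
  0 < pm -> 0 < L -> (forall j i, a j i <= pm) -> n <= 2 ^ m * 2 ^ m ->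
  m * n <= N ->
  #|[pred t : N.-tuple bool | ~~ [forall j, forall k : 'I_(2 ^ m).+1,
      let s := \sum_(i < n) (if tape_key m t i < k then a j i else 0) in
      let tot := \sum_(i < n) a j i in
      (2 ^ m * s <= tot * k + 2 ^ m * (7 * 2 ^ m * pm * L)) &&
      (tot * k <= 2 ^ m * s + 2 ^ m * (7 * 2 ^ m * pm * L))]]| * 2 ^ (3 * L)
  <= 2 ^ N * (#|I| * (2 ^ m).+1 * 2).
Proof.
move=> pm0 L0 apm nM leN; have -> : N = m * n + (N - m * n) by rewrite subnKC.
move: (N - m * n) => rest.
set D0 := 7 * _ * _ * _.
pose s j (k : nat) (t : seq bool) := \sum_(i < n) (if tape_key m t i < k then a j i else 0).
pose tot j := \sum_(i < n) a j i.
pose up j (k : 'I_(2 ^ m).+1) (t : (m * n + rest).-tuple bool) :=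
  tot j * k + 2 ^ m * D0 < 2 ^ m * s j k t.
pose dn j (k : 'I_(2 ^ m).+1) (t : (m * n + rest).-tuple bool) :=
  2 ^ m * s j k t + 2 ^ m * D0 < tot j * k.
pose bad (x : I * 'I_(2 ^ m).+1 * bool) := if x.2 then up x.1.1 x.1.2 else dn x.1.1 x.1.2.
apply: leq_trans (_ : (\sum_x #|bad x|) * 2 ^ (3 * L) <= _).
  rewrite leq_mul2r; apply/orP; right; apply: leq_trans (card_exists_le bad).
  apply: subset_leq_card; apply/subsetP=> t; rewrite !inE negb_forall.
  case/existsP=> j; rewrite negb_forall => /existsP[k]; rewrite negb_and -!ltnNge.
  by case/orP=> h; apply/existsP; [exists (j, k, true) | exists (j, k, false)].
(* The abstract exponential is instantiated here by the one on the reals. *)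
have expD (x y : Rdefinitions.R) : Rtrigo_def.exp (x + y)%R =
    (Rtrigo_def.exp x * Rtrigo_def.exp y)%R by exact: Exp_prop.exp_plus.
have exp_ge (x : Rdefinitions.R) : (1 + x <= Rtrigo_def.exp x)%R.
  by apply/RleP; exact: Rpower.exp_ineq1_le.
rewrite big_distrl /=.
apply: leq_trans (_ : \sum_(x : I * 'I_(2 ^ m).+1 * bool) 2 ^ (m * n + rest) <= _).
  apply: leq_sum => -[[j k] [|]] _.
    apply: (@window_above _ _ expD exp_ge m n rest pm k L (a j)) => //.
    by rewrite -ltnS.
  apply: (@window_below _ _ expD exp_ge m n rest pm k L (a j)) => //.
  by rewrite -ltnS.
by rewrite sum_nat_const !card_prod card_ord card_bool mulnC.
Qed.

(** * The program *)

(* Registers: 0 best profit so far, 1 one, 2 X (item i sits at X+1+2i, X+2+2i),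
   3 W, 4 n, 5 pmax, 6 number of buckets, 7 its logarithm, 8 the search step s,
   9 L, 10 D, 11 base of the keys, 12 base of the array, 13 size of the array,
   14 zero, 15 two, 16 V, 17 k, 18 lo, 19 hi, 20 i, 21 to 30 scratch, 31 W+1,
   32 n * pmax. *)
Definition saves (j c : nat) : seq instr :=
  flatten [seq [:: IAdd 0 0 1; IStore 0 i.+2] | i <- iota j c].

(* The input fills the low cells, and the only ones known not to hold an item
   are 0 and 1.  Overwriting n by 64 (n + W), the address of a free cell, loses
   no information once W is stored there. *)
Definition prologue : cmd :=
  IAdd 0 0 1 ;; IAdd 0 0 0 ;; IAdd 0 0 0 ;; IAdd 0 0 0 ;; IAdd 0 0 0 ;;
  IAdd 0 0 0 ;; IAdd 0 0 0 ;; IStore 0 1 ;; IConst 1 1 ;;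
  block (saves 0 40)
  (IConst 2 40 ;; ISub 2 0 2 ;; ILoad 3 2 ;; IConst 4 64 ;; IDiv 4 2 4 ;;
   ISub 4 4 3 ;; IConst 14 0 ;; IConst 15 2 ;;
   IConst 20 41 ;; IAdd 21 4 4 ;; IAdd 21 21 1 ;;
   While 20 21 (IAdd 22 2 20 ;; IAdd 20 20 1 ;; ILoad 24 20 ;; IStore 22 24)).

(** Adding register 14, which holds zero, is how a register is copied. *)
Definition compute_pmax : cmd :=
  IConst 5 0 ;; IConst 20 0 ;; IAdd 21 2 15 ;;
  While 20 4 (ILoad 22 21 ;; If 5 22 (IAdd 5 22 14) ;; IAdd 21 21 15 ;;
    IAdd 20 20 1).

Definition compute_buckets : cmd :=
  IConst 6 1 ;; IConst 7 0 ;; IConst 21 1 ;;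
  While 21 4 (IAdd 6 6 6 ;; IAdd 7 7 1 ;; IMul 21 6 6).

(** The first search step is a power of two above [n * pmax], hence above OPT. Its bit length [L]
    doubles as the logarithmic factor of [D] and as the number of rounds. *)
Definition compute_step : cmd :=
  IMul 32 4 5 ;; IAdd 21 32 1 ;; IConst 8 1 ;; IConst 9 1 ;;
  While 8 21 (IAdd 8 8 8 ;; IAdd 9 9 1).

Definition compute_bases : cmd :=
  IConst 10 8 ;; IMul 10 10 6 ;; IMul 10 10 5 ;; IMul 10 10 9 ;;
  IAdd 11 2 4 ;; IAdd 11 11 4 ;; IAdd 11 11 1 ;; IAdd 12 11 4 ;;
  IAdd 13 32 8 ;; IAdd 13 13 10 ;; IAdd 13 13 1 ;; IAdd 31 3 1.

Definition draw_keys : cmd :=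
  IConst 20 0 ;;
  While 20 4 (IConst 22 0 ;; IConst 21 0 ;;
    While 21 7 (IRand 23 ;; IAdd 22 22 22 ;; IAdd 22 22 23 ;; IAdd 21 21 1) ;;
    IAdd 24 11 20 ;; IStore 24 22 ;; IAdd 20 20 1).

(** Positions are visited downwards, so the array is updated in place: the entry read has not yet
    been rewritten, and no item is used twice. *)
Definition row_loop : cmd :=
  While 25 26 (ISub 26 26 1 ;; IAdd 27 12 26 ;; ISub 28 27 24 ;; ILoad 28 28 ;;
    IAdd 28 28 23 ;; ILoad 30 27 ;;
    If 28 30 (IStore 27 28 ;; If 0 26 (IAdd 0 26 14))).

Definition row : cmd :=
  IAdd 21 20 20 ;; IAdd 21 21 2 ;; IAdd 21 21 1 ;; ILoad 23 21 ;;
  IAdd 21 21 1 ;; ILoad 24 21 ;; IAdd 25 18 14 ;;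
  If 25 24 (IAdd 25 24 14) ;; IAdd 26 19 1 ;; row_loop.

(** There is no equality test: the two truncated differences of key and [k] add up to their
    distance, which is below 1 exactly for the items of the bucket. *)
Definition bucket : cmd :=
  IMul 18 16 17 ;; IDiv 18 18 6 ;; ISub 18 18 10 ;; IAdd 21 17 1 ;;
  IMul 19 16 21 ;; IDiv 19 19 6 ;; IAdd 19 19 10 ;; IConst 20 0 ;;
  While 20 4 (IAdd 21 11 20 ;; ILoad 22 21 ;; ISub 21 22 17 ;; ISub 22 17 22 ;;
    IAdd 21 21 22 ;; If 21 1 row ;; IAdd 20 20 1) ;;
  IAdd 17 17 1.

Definition round : cmd :=
  IAdd 16 0 8 ;; IConst 26 0 ;;
  While 26 13 (IAdd 27 12 26 ;; IStore 27 31 ;; IAdd 26 26 1) ;;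
  IStore 12 14 ;; IConst 17 0 ;; While 17 6 bucket ;; IDiv 8 8 15.

Definition search : cmd := IConst 0 0 ;; While 14 8 round.

Definition knapsack : cmd :=
  prologue ;; compute_pmax ;; compute_buckets ;; compute_step ;;
  compute_bases ;; draw_keys ;; search.

Lemma upd_eq m a v : upd m a v a = v.
Proof. by rewrite /upd eqxx. Qed.

Lemma upd_ne m a v x : x != a -> upd m a v x = m x.
Proof. by rewrite /upd => /negbTE->. Qed.

Lemma upd_low m a v x : 64 <= a -> x < 64 -> upd m a v x = m x.
Proof. by move=> h1 h2; apply: upd_ne; lia. Qed.

Lemma upd_high m a v x : a < 64 -> 64 <= x -> upd m a v x = m x.
Proof. by move=> h1 h2; apply: upd_ne; lia. Qed.

(** * Correctness and cost of each phase *)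

Section Correctness.

Variables (W : nat) (items : seq (nat * nat)) (tape : seq bool) (B : nat).
Notation n := (size items).
Variables (X pm mm M U e s0 D KB AB SZ wt G : nat).
Hypotheses (XE : X = 64 * (n + W)) (pmE : pm = pmax items)
  (mmE : mm = up_log 4 n) (ME : M = 2 ^ mm) (UE : U = n * pm)
  (eE : e = up_log 2 U.+1) (s0E : s0 = 2 ^ e) (DE : D = 8 * M * pm * e.+1)
  (KBE : KB = X + n + n + 1) (ABE : AB = KB + n) (SZE : SZ = U + s0 + D + 1)
  (wtE : wt = \sum_(x <- items) x.1).
(** [G] is a common bound for addresses and stored values; [G * G] accommodates the products formed
    on the way, such as [V * k]. *)
Hypothesis GE : G = AB + SZ + wt + W + M + s0 + pm + 64.
Hypothesis GB : G * G <= B.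
Hypothesis W0 : 0 < W.
Hypothesis tapeE : mm * n <= size tape.

Let G2B : 4 * G <= B.
Proof. by apply: leq_trans GB; rewrite leq_mul2r GE; lia. Qed.
Let B64 : 64 <= B. Proof. by apply: leq_trans G2B; lia. Qed.
Let ltB x : x < 4 * G -> x < B. Proof. by move=> h; exact: leq_trans h G2B. Qed.
Let wE i : item_w items i <= wt.
Proof.
rewrite wtE /item_w; case: (ltnP i n) => [lt|ge]; last by rewrite nth_default.
by rewrite (big_nth (0, 0)) big_mkord (bigD1 (Ordinal lt)) //= leq_addr.
Qed.
Let pE i : item_p items i <= pm.
Proof. by rewrite pmE; exact: item_p_le_pmax. Qed.

Ltac one_step :=
  cbv beta;
  lazymatch goal with |- wp _ (Seq _ _) _ _ _ => apply: wp_seq | _ => idtac end;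
  let v := fresh "v" in let E := fresh "E" in
  lazymatch goal with
  | |- wp _ (Prim (IConst _ _)) _ _ _ =>
      apply: (wp_const B64) => // v E; split; [rewrite E; apply: ltB; lia|]
  | |- wp _ (Prim (IAdd _ _ _)) _ _ _ =>
      apply: (wp_add B64) => // v E; rewrite /upd /= in E
  | |- wp _ (Prim (ISub _ _ _)) _ _ _ =>
      apply: (wp_sub B64) => // v E; rewrite /upd /= in E
  | |- wp _ (Prim (IMul _ _ _)) _ _ _ =>
      apply: (wp_mul B64) => // v E; rewrite /upd /= in E
  | |- wp _ (Prim (IDiv _ _ _)) _ _ _ =>
      apply: (wp_div B64) => // v E; rewrite /upd /= in E
  | |- wp _ (Prim (ILoad _ _)) _ _ _ =>
      apply: (wp_load B64) => //; [|move=> v E; rewrite /upd /= in E]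
  | |- wp _ (Prim (IStore _ _)) _ _ _ => apply: wp_store => //; rewrite /upd /=
  end.

Record layout (m : nat -> nat) : Prop := Layout {
  lay1 : m 1 = 1; lay2 : m 2 = X; lay3 : m 3 = W; lay4 : m 4 = n;
  lay14 : m 14 = 0; lay15 : m 15 = 2;
  layw : forall i, i < n -> m (X + 1 + 2 * i) = item_w items i;
  layp : forall i, i < n -> m (X + 2 + 2 * i) = item_p items i }.

Lemma layout_reg m a v :
  (a == 0) || (4 < a < 64) && (a != 14) && (a != 15) -> layout m ->
  layout (upd m a v).
Proof.
move=> h [? ? ? ? ? ? hw hp]; split; try (rewrite upd_ne //; lia).
  by move=> i lt; rewrite upd_high ?hw; lia.
by move=> i lt; rewrite upd_high ?hp; lia.
Qed.

Lemma init_mem_ltG x : init_mem W items x < G.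
Proof.
rewrite /init_mem; case: ifP => _; first by lia.
case: ifP => _; first by lia.
case: ifP => _; last by lia.
by case: ifP => _; [have := pE ((x - 3)./2) | have := wE ((x - 2)./2)]; lia.
Qed.

(** Only registers 0 and 1 are available at this stage, too few for a loop, so the copy is unrolled
    and register 0 is the moving destination. Sources stay below 64 and destinations above, so no
    source is overwritten. *)
Lemma wp_saves c j rest Q m t :
  m 1 = 1 -> 64 <= m 0 -> m 0 + c < B -> j + c <= 62 ->
  (forall x, 1 < x < 64 -> m x < B) ->
  (forall m', m' 0 = m 0 + c ->
     (forall x : nat, x != 0 -> m' x =
        if m 0 < x <= m 0 + c then m (j + 2 + (x - (m 0).+1)) else m x) ->
     wp B rest (fun m2 t2 k => Q m2 t2 (2 * c + k)) m' t) ->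
  wp B (block (saves j c) rest) Q m t.
Proof.
elim: c j m Q => [|c IH] j m Q m1 m0 mB jc mx post /=.
  apply: post => [|x x0]; first by rewrite addn0.
  by case: ifP => //; lia.
one_step; split; first by lia.
apply: wp_seq; apply: wp_store; first by rewrite /upd /=; lia.
  by rewrite /upd /=; apply: mx; lia.
have vE : v = (m 0).+1 by lia.
have E0 : upd m 0 v 0 = v by rewrite upd_eq.
have Ej : upd m 0 v j.+2 = m j.+2 by rewrite upd_ne.
rewrite E0 Ej; set m2 := upd (upd _ _ _) _ _.
have m20 : m2 0 = v by rewrite /m2 upd_low ?upd_eq //; lia.
have m2x x : 0 < x < 64 -> m2 x = m x.
  by move=> lt; rewrite /m2 upd_low ?upd_ne //; lia.
apply: IH; rewrite ?m20 ?m2x //; try lia.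
  by move=> x lt; rewrite m2x ?mx //; lia.
move=> m' m'0 m'x; apply: wp_mono (post m' _ _) _; first by rewrite m'0; lia.
  move=> x x0; rewrite m'x //; case: ifP => h1; case: ifP => h2; try lia.
  - rewrite m2x; last by lia.
    by congr m; lia.
  - rewrite /m2; case: (eqVneq x v) => [->|ne]; last by lia.
    by rewrite upd_eq; congr m; lia.
  - by rewrite /m2 !upd_ne //; lia.
by move=> m3' t' k q; rewrite (_ : 1 + _ = 2 * c.+1 + k) //; lia.
Qed.

(** Six doublings of [n + W] give [X], beyond the whole input. Once cells 2 to 41 are saved they can
    serve as registers, and [n] is recovered as [X / 64 - W]. The loop then moves the input from
    cell 42 on, which no register overlaps. *)
Lemma wp_prologue t :
  wp B prologue (fun m t' k => [/\ layout m, t' = t & k <= 12 * n + 110])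
    (init_mem W items) t.
Proof.
have iG := init_mem_ltG; set im := init_mem W items in iG *.
have im0 : im 0 = n by []. have im1 : im 1 = W by [].
rewrite /prologue; do 7 (one_step; split; first by lia).
have vX : v5 = X by lia.
apply: wp_seq; apply: wp_store; [by rewrite /upd /=; lia|by rewrite /upd /=; lia|].
one_step.
set m1 := upd _ 1 _.
have m1x x : m1 x = if x == 1 then 1 else if x == X then W else if x == 0 then X else im x.
  rewrite /m1 E6 vX /upd; case: eqP => // ne; case: eqP => // _.
  by case: x ne.
have m11 : m1 1 = 1 by rewrite m1x.
have m10 : m1 0 = X by rewrite m1x /= ifF //; lia.
apply: (wp_saves (c := 40) (j := 0)) => //; rewrite ?m10; try lia.
  by move=> x lt; rewrite m1x; do 3 (case: ifP => _; first by lia); have := iG x; lia.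
move=> m2 m20 m2x.
have m1i x : 1 < x < X -> m1 x = im x.
  by move=> lt; rewrite m1x; do 3 (case: eqP => [|_]; first by lia).
have src x : 42 <= x < X -> m2 x = im x.
  move=> lt; rewrite m2x; last by lia.
  by case: ifP => h; [lia | rewrite m1i; lia].
have dst y : 0 < y <= 40 -> m2 (X + y) = im y.+1.
  move=> lt; rewrite m2x; last by lia.
  by case: ifP => h; [rewrite m1i; [congr im|]; lia | lia].
have m21 : m2 1 = 1 by rewrite m2x //; case: ifP => h; [lia | rewrite m1x].
have m2X : m2 X = W.
  rewrite m2x; last by lia.
  by case: ifP => h; [lia | rewrite m1x eqxx; case: eqP => //; lia].
clear m1i m1x m11 m10; move: m1 m2x => m1 _.
one_step. one_step; split; first by lia.
have v8X : v8 = X by lia.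
one_step; first by rewrite /upd /=; lia.
have v9W : v9 = W by move: E9; do ?(case: eqP => [|_]; first by lia); rewrite v8X m2X.
split; first by lia.
one_step. one_step.
have v11E : v11 = n + W by rewrite E11 v8X E10 XE mulKn.
split; first by lia.
one_step; split; first by lia.
one_step. one_step. one_step. one_step; split; first by lia.
one_step; split; first by lia.
(* Of the [2 n] item cells 40 are already saved; the difference is 0 for short inputs. *)
pose N := 2 * n - 40.
apply: (wp_while (N := N) (cost := fun=> 4) (I := fun j m' t' =>
  [/\ [/\ m' 1 = 1, m' 2 = X, m' 3 = W & m' 4 = n],
      [/\ m' 14 = 0, m' 15 = 2, m' 20 = 41 + j & m' 21 = 2 * n + 1],
      forall y, 0 < y < 41 + j -> m' (X + y) = im y.+1,
      forall x, 42 <= x < X -> m' x = im x & t' = t])).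
- split=> //; try (split; rewrite /upd //=; lia).
    by move=> y lt; rewrite !upd_high ?dst //; lia.
  by move=> x lt; rewrite !upd_ne ?src //; lia.
- move=> j m' t' ltj [[m'1 m'2 m'3 m'4] [m'14 m'15 m'20 m'21] cpy src' ->].
  rewrite m'20 m'21; split; first by rewrite /N in ltj; lia.
  one_step; rewrite m'2 m'20 in E18; split; first by lia.
  one_step; rewrite m'20 m'1 in E19; split; first by lia.
  one_step; first by rewrite /upd /=; lia.
  have ge : 42 <= v19 by lia.
  have ltX : v19 < X by rewrite /N in ltj; lia.
  have v20E : v20 = im v19.
    by move: E20; do ?(case: eqP => [|_]; first by lia); rewrite src' // ge.
  split; first by have := iG v19; lia.
  apply: wp_store; [by rewrite /upd /=; lia | by rewrite /upd /=; have := iG v19; lia |].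
  rewrite (_ : upd _ 24 _ 22 = v18) // (_ : upd _ 24 _ 24 = v20) //.
  split=> //; split=> //.
  + by split; rewrite upd_low // /upd /=; lia.
  + by split; rewrite upd_low // /upd /=; lia.
  + move=> y lt; case: (eqVneq (X + y) v18) => [Ey|ne].
      by rewrite Ey upd_eq v20E; congr im; lia.
    by rewrite upd_ne // !upd_high ?cpy //; lia.
  + by move=> x lt; rewrite !upd_ne ?src' //; lia.
- by move=> m' t' [_ [_ _ -> ->] _ _ _]; rewrite /N; lia.
move=> m' t' k [[? ? ? ?] [? ? _ _] cpy _ ->]; rewrite sum_nat_const card_ord => le.
split=> //; last by rewrite /N in le; lia.
split=> //.
- move=> i lt; rewrite -addnA cpy; last by rewrite /N; lia.
  rewrite /im /init_mem /= ifT; last by lia.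
  by rewrite ifF; [congr item_w; lia | lia].
- move=> i lt; rewrite -addnA cpy; last by rewrite /N; lia.
  rewrite /im /init_mem /= ifT; last by lia.
  by rewrite ifT; [congr item_p; lia | lia].
Qed.

Lemma wp_compute_pmax m t : layout m ->
  wp B compute_pmax (fun m' t' k =>
    [/\ layout m', m' 5 = pm, t' = t & k <= 12 * n + 10]) m t.
Proof.
move=> lay; rewrite /compute_pmax.
one_step. one_step. one_step; split; first by rewrite E1 (lay2 lay) (lay15 lay); lia.
apply: (wp_while (N := n) (cost := fun=> 8) (I := fun i m' t' =>
  [/\ layout m', m' 5 = \max_(j < i) item_p items j, m' 20 = i,
      m' 21 = X + 2 + 2 * i & t' = t])).
- split=> //; rewrite ?big_ord0 //; do ?apply: layout_reg => //.
  by rewrite /upd /= E1 (lay2 lay) (lay15 lay); lia.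
- move=> j m' t' ltj [lay' m5 m20 m21 ->]; rewrite m20 (lay4 lay'); split=> //.
  have pj := pE j; have mj := layp lay' ltj.
  one_step; first by rewrite m21; lia.
  rewrite m21 mj in E2; split; first by lia.
  apply: wp_seq; apply: wp_if; rewrite {1 2}/upd /= => cmp.
    one_step; rewrite (lay14 lay') addn0 in E3; split; first by lia.
    one_step; rewrite m21 (lay15 lay') in E4; split; first by lia.
    one_step; rewrite m20 (lay1 lay') in E5; split; first by lia.
    split=> //; split=> //; try by rewrite /upd /=; lia.
      by do 4 apply: layout_reg => //.
    by rewrite /upd /= big_ord_recr /= -m5; lia.
  one_step; rewrite m21 (lay15 lay') in E3; split; first by lia.
  one_step; rewrite m20 (lay1 lay') in E4; split; first by lia.
  split=> //; split=> //; try by rewrite /upd /=; lia.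
    by do 3 apply: layout_reg => //.
  by rewrite /upd /= big_ord_recr /= -m5; lia.
- by move=> m' t' [lay' _ m20 _ _]; rewrite m20 (lay4 lay').
move=> m' t' k [lay' m5 _ _ ->]; rewrite sum_nat_const card_ord => le.
split=> //; last by lia.
rewrite m5 pmE /pmax (big_nth (0, 0)) big_mkord //.
Qed.

Let ltBB x y : x < G -> y < G -> x * y < B.
Proof. by move=> hx hy; apply: leq_trans (ltn_mul hx hy) GB. Qed.

Let wp_cost (C N k : nat) : k <= \sum_(j < N) (C + 2) + 2 -> k <= N * (C + 2) + 2.
Proof. by rewrite sum_nat_const card_ord. Qed.

Lemma wp_compute_buckets m t : layout m ->
  wp B compute_buckets (fun m' t' k =>
    [/\ layout m', [/\ m' 5 = m 5, m' 6 = M & m' 7 = mm], t' = t &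
        k <= 5 * mm + 5]) m t.
Proof.
move=> lay; rewrite /compute_buckets.
one_step. one_step. one_step.
apply: (wp_while (N := mm) (cost := fun=> 3) (I := fun j m' t' =>
  [/\ layout m', [/\ m' 5 = m 5, m' 6 = 2 ^ j & m' 7 = j],
      m' 21 = 2 ^ j * 2 ^ j & t' = t])).
- by split=> //; do 3 apply: layout_reg => //.
- move=> j m' t' ltj [lay' [m'5 m'6 m'7] m'21 ->]; rewrite m'21 (lay4 lay').
  (* The loop stops at the least [j] with [n <= 4 ^ j], whence the base 4 in [mm]. *)
  have lt2 : 2 ^ j * 2 ^ j < n.
    rewrite ltnNge; apply/negP => le; move: ltj; rewrite mmE ltnNge => /negP; apply.
    by apply: up_log_min => //; rewrite (expnMn 2 2).
  have leM : 2 ^ j.+1 <= M by rewrite ME leq_exp2l.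
  have ltmm : mm < M by rewrite ME ltn_expl.
  have eS : 2 ^ j + 2 ^ j = 2 ^ j.+1 by rewrite expnS; lia.
  split=> //.
  one_step; rewrite m'6 eS in E2; split; first by apply: ltB; lia.
  one_step; rewrite m'7 (lay1 lay') in E3; split; first by apply: ltB; lia.
  one_step; split; first by rewrite E4; apply: ltBB; lia.
  split=> //; split=> //.
  + by do 3 apply: layout_reg => //.
  + by split; rewrite /upd /= // E3 addn1.
  + by rewrite /upd /= E4 E2.
- move=> m' t' [lay' _ -> _]; rewrite (lay4 lay') mmE -expnMn.
  exact: (@up_logP 4).
move=> m' t' k [lay' [-> -> ->] _ ->] /wp_cost le.
by split=> //; rewrite -?ME //; lia.
Qed.

Lemma wp_compute_step m t : layout m -> m 5 = pm ->
  wp B compute_step (fun m' t' k =>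
    [/\ layout m', [/\ m' 5 = pm, m' 6 = m 6 & m' 7 = m 7],
        [/\ m' 8 = s0, m' 9 = e.+1 & m' 32 = U], t' = t &
        k <= 4 * e + 6]) m t.
Proof.
move=> lay m5; rewrite /compute_step.
one_step; rewrite m5 (lay4 lay) -UE in E; split; first by lia.
one_step; rewrite (lay1 lay) in E0; split; first by lia.
one_step. one_step.
apply: (wp_while (N := e) (cost := fun=> 2) (I := fun j m' t' =>
  [/\ layout m', [/\ m' 5 = pm, m' 6 = m 6 & m' 7 = m 7],
    [/\ m' 8 = 2 ^ j, m' 9 = j.+1, m' 32 = U & m' 21 = U.+1] & t' = t])).
- split=> //; first by do 4 apply: layout_reg => //.
  by split; rewrite /upd /= ?E //; lia.
- move=> j m' t' ltj [lay' [m'5 m'6 m'7] [m'8 m'9 m'32 m'21] ->].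
  rewrite m'8 m'21.
  have lt2 : 2 ^ j < U.+1.
    rewrite ltnNge; apply/negP => le; move: ltj; rewrite eE ltnNge => /negP; apply.
    exact: up_log_min.
  have les : 2 ^ j.+1 <= s0 by rewrite s0E leq_exp2l.
  have lte : e < s0 by rewrite s0E ltn_expl.
  have eS : 2 ^ j + 2 ^ j = 2 ^ j.+1 by rewrite expnS; lia.
  split=> //.
  one_step; rewrite m'8 eS in E3; split; first by apply: ltB; lia.
  one_step; rewrite m'9 (lay1 lay') addn1 in E4; split; first by apply: ltB; lia.
  split=> //; split=> //; first by do 2 apply: layout_reg => //.
- by move=> m' t' [lay' _ [-> _ _ ->] _]; rewrite eE; exact: up_logP.
move=> m' t' k [lay' ? [-> ? ? _] ->] /wp_cost le.
by split=> //; rewrite -?s0E //; lia.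
Qed.

Record env (m : nat -> nat) : Prop := Env {
  env_layout : layout m; env6 : m 6 = M; env7 : m 7 = mm; env10 : m 10 = D;
  env11 : m 11 = KB; env12 : m 12 = AB; env13 : m 13 = SZ; env31 : m 31 = W.+1 }.

Lemma env_reg m a v : (a == 0) || (a == 8) || (15 < a < 31) -> env m -> env (upd m a v).
Proof.
move=> h [lay *]; split; try (rewrite upd_ne //; lia).
by apply: layout_reg => //; lia.
Qed.

Lemma env_heap m a v : KB <= a -> env m -> env (upd m a v).
Proof.
move=> h [[? ? ? ? ? ? hw hp] *]; split; try (rewrite upd_low //; lia).
split; try (rewrite upd_low //; lia).
- by move=> i lt; rewrite upd_ne ?hw //; lia.
- by move=> i lt; rewrite upd_ne ?hp //; lia.
Qed.

Lemma wp_compute_bases m t : layout m -> m 5 = pm -> m 6 = M -> m 7 = mm ->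
    m 9 = e.+1 -> m 8 = s0 -> m 32 = U ->
  wp B compute_bases (fun m' t' k =>
    [/\ env m', m' 8 = s0, t' = t & k <= 12]) m t.
Proof.
move=> lay h5 h6 h7 h9 h8 h32; rewrite /compute_bases.
have := lay1 lay; have := lay2 lay; have := lay3 lay; have := lay4 lay => h4 h3 h2 h1.
have leD : 8 * M * pm <= D by rewrite DE leq_pmulr.
one_step.
one_step; rewrite E h6 in E0; split; first by rewrite E0; apply: ltBB; lia.
one_step; rewrite E0 h5 in E1; split; first by apply: ltB; lia.
one_step; rewrite E1 h9 -DE in E2; split; first by apply: ltB; lia.
do 8 (one_step; split; first by apply: ltB; lia).
split=> //; split; try by rewrite /upd /=; lia.
by do 12 apply: layout_reg => //.
Qed.

Lemma bits_lt acc u : bits acc u < acc.+1 * 2 ^ size u.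
Proof.
elim: u acc => [|b u IH] acc /=; first by rewrite muln1.
by apply: leq_trans (IH _) _; rewrite expnS mulnA leq_mul2r; case: b; lia.
Qed.

Definition keyed (m : nat -> nat) (i : nat) : Prop :=
  forall j, j < i -> m (KB + j) = tape_key mm tape j.

Lemma keyed_reg m a v i : a < 64 -> keyed m i -> keyed (upd m a v) i.
Proof. by move=> h km j lt; rewrite upd_high ?km //; lia. Qed.

Lemma wp_draw_keys m : env m -> m 8 = s0 ->
  wp B draw_keys (fun m' _ k =>
    [/\ env m', keyed m' n, m' 8 = s0 & k <= n * (6 * mm + 9) + 3]) m tape.
Proof.
move=> em h8; rewrite /draw_keys; one_step.
have ltmm : mm < M by rewrite ME ltn_expl.
apply: (wp_while (N := n) (cost := fun=> 6 * mm + 7) (I := fun i m' t' =>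
  [/\ env m', keyed m' i, m' 8 = s0, m' 20 = i & t' = drop (mm * i) tape])).
- split=> //; first exact: env_reg.
  by rewrite muln0 drop0.
- move=> i m' t' lti [em' km' m'8 m'20 ->]; rewrite m'20 (lay4 (env_layout em')).
  split=> //; one_step. one_step.
  apply: wp_seq; apply: (wp_while (N := mm) (cost := fun=> 4) (I := fun j m2 t2 =>
    [/\ env m2, keyed m2 i, [/\ m2 8 = s0, m2 20 = i & m2 21 = j],
      m2 22 = bits 0 (take j (drop (mm * i) tape)) & t2 = drop (mm * i + j) tape])).
  + split; try by rewrite /upd /= ?E0 ?take0 ?addn0.
      by do 2 apply: env_reg => //.
    by do 2 apply: keyed_reg => //.
  + move=> j m2 t2 ltj [em2 km2 [h2 h3 h4] h5 ->]; rewrite h4 (env7 em2).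
    have ltN : mm * i + j < size tape by apply: leq_trans tapeE; nia.
    have szd : j < size (drop (mm * i) tape) by rewrite size_drop; lia.
    split=> //; rewrite (drop_nth false ltN); apply: wp_seq.
    apply: (wp_rand B64) => // v2 E2.
    have v2b : v2 <= 1 by rewrite E2; case: nth.
    have ltb : m2 22 < 2 ^ j.
      by rewrite h5; apply: leq_trans (bits_lt _ _) _; rewrite mul1n size_take szd.
    have leM : 2 ^ j <= M by rewrite ME leq_exp2l // ltnW.
    one_step; split; first by apply: ltB; lia.
    one_step; split; first by apply: ltB; lia.
    one_step; rewrite h4 (lay1 (env_layout em2)) in E5; split; first by apply: ltB; lia.
    split=> //; split.
    * by do 4 apply: env_reg => //.
    * by do 4 apply: keyed_reg => //.
    * by split; rewrite /upd //=; lia.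
    * rewrite /upd /= (take_nth false) // /bits foldl_rcons -/(bits _ _) -h5 E4 E3 E2 nth_drop.
      by [].
    * by rewrite addnS.
  + by move=> m2 t2 [em2 _ [_ _ ->] _ _]; rewrite (env7 em2).
  move=> m2 t2 k2 [em2 km2 [h2 h3 h4] h5 ->] /wp_cost le2.
  have lt22 : m2 22 < M.
    rewrite h5 ME; apply: leq_trans (bits_lt _ _) _; rewrite mul1n leq_exp2l //.
    by rewrite size_take; case: ifP => //; lia.
  one_step; rewrite (env11 em2) h3 in E2; split; first by apply: ltB; lia.
  apply: wp_seq; apply: wp_store; first by rewrite /upd /=; apply: ltB; lia.
    by rewrite /upd /=; apply: ltB; lia.
  rewrite (_ : upd _ 24 _ 24 = v2) // (_ : upd _ 24 _ 22 = m2 22) //.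
  have v64 : 64 <= v2 by lia.
  have em3 : env (upd (upd m2 24 v2) v2 (m2 22)).
    by apply: env_heap; [lia | exact: env_reg].
  have km3 : keyed (upd (upd m2 24 v2) v2 (m2 22)) i.+1.
    move=> j; rewrite ltnS leq_eqVlt => /predU1P[->|lt].
      by rewrite -E2 upd_eq h5.
    by rewrite upd_ne ?upd_high ?km2 //; lia.
  have m38 : upd (upd m2 24 v2) v2 (m2 22) 8 = s0 by rewrite upd_low.
  have m320 : upd (upd m2 24 v2) v2 (m2 22) 20 = i by rewrite upd_low.
  move: {em3 km3 m38 m320}(upd _ _ _) em3 km3 m38 m320 => m3 em3 km3 m38 m320.
  one_step; rewrite m320 (lay1 (env_layout em3)) in E3; split; first by apply: ltB; lia.
  split=> [|//]; last by lia.
  split=> //; first exact: env_reg.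
  + exact: keyed_reg.
  + by rewrite /upd /= E3 addn1.
  + by rewrite mulnS addnC.
- by move=> m' t' [em' _ _ -> _]; rewrite (lay4 (env_layout em')).
move=> m' t' k [em' km' m'8 _ _] /wp_cost le; split=> //.
by rewrite add1n addn3 ltnS (leq_trans le) // -addnA addn2.
Qed.

(** Frame of a row: these registers hold the state of the enclosing loops, and the cells from 64 up
    to [AB] hold the moved items and the keys. *)
Definition keeps (m m' : nat -> nat) : Prop :=
  env m' /\ forall x, [|| x == 8, 15 < x < 21 | 64 <= x < AB] -> m' x = m x.

Lemma keeps_reg m m' a v : (a == 0) || (20 < a < 31) ->
  keeps m m' -> keeps m (upd m' a v).
Proof.
move=> h [em' k]; split=> [|x hx]; first by apply: env_reg => //; lia.
by rewrite upd_ne ?k //; lia.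
Qed.

Lemma keeps_heap m m' a v : AB <= a -> keeps m m' -> keeps m (upd m' a v).
Proof.
move=> h [em' k]; split=> [|x hx]; first by apply: env_heap => //; lia.
by rewrite upd_ne ?k //; lia.
Qed.

(** New entries are described through the array [f] at entry. This is possible because before turn
    [j] only positions from [h.+1 - j] on may have changed, and both cells read lie below. *)
Lemma wp_row_loop m t l h w p :
  let f q := m (AB + q) in
  env m -> m 23 = w -> m 24 = p -> m 25 = l -> m 26 = h.+1 ->
  h < SZ -> p <= l -> w <= wt -> m 0 < G ->
  (forall q, q < SZ -> f q <= W.+1) ->
  wp B row_loop (fun m' t' k =>
    [/\ keeps m m', t' = t, k <= 12 * (h.+1 - l) + 2,
        forall q, q < SZ -> m' (AB + q) =
          if improves f l h w p q then f (q - p) + w else f q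
      & [/\ m 0 <= m' 0, forall q, improves f l h w p q -> q <= m' 0
          & m' 0 = m 0 \/ improves f l h w p (m' 0)]]) m t.
Proof.
move=> f em m23 m24 m25 m26 hS pl ww mG fW.
apply: (wp_while (N := h.+1 - l) (cost := fun=> 10) (I := fun j m' t' =>
  [/\ keeps m m', t' = t,
      [/\ m' 23 = w, m' 24 = p, m' 25 = l & m' 26 = h.+1 - j],
      forall q, q < SZ -> m' (AB + q) =
        if (h.+1 - j <= q) && improves f l h w p q then f (q - p) + w else f q
    & [/\ m 0 <= m' 0,
          forall q, h.+1 - j <= q -> improves f l h w p q -> q <= m' 0
        & m' 0 = m 0 \/ improves f l h w p (m' 0)]])).
- split=> //.
  + by move=> q lt; case: ifP => // /andP[le /andP[]]; lia.
  + by split=> //; [move=> q le /andP[]; lia | left].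
- move=> j m' t' ltj [kp -> [m'23 m'24 m'25 m'26] arr [le0 imp bst]].
  have [em' _] := kp; have lay := env_layout em'.
  rewrite m'25 m'26; split; first by lia.
  pose q := h - j; have qE : h.+1 - j = q.+1 by rewrite /q; lia.
  have lq : l <= q <= h by rewrite /q; lia.
  have m'0G : m' 0 < G.
    by case: bst => [->//|/andP[/andP[_ le] _]]; apply: leq_ltn_trans le _; lia.
  rewrite qE in m'26 arr imp.
  one_step; rewrite m'26 (lay1 lay) in E; split; first by apply: ltB; lia.
  one_step; rewrite (env12 em') in E0; split; first by apply: ltB; lia.
  one_step; rewrite m'24 in E1; split; first by apply: ltB; lia.
  have fqp : m' (AB + (q - p)) = f (q - p).
    by rewrite arr; [rewrite ifF //; apply/negbTE; rewrite negb_and; lia | lia].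
  have fq : m' (AB + q) = f q by rewrite arr ?ltnn //; lia.
  have fqpW : f (q - p) <= W.+1 by apply: fW; lia.
  have fqW : f q <= W.+1 by apply: fW; lia.
  one_step; first by rewrite /upd /=; apply: ltB; lia.
  have v2E : v2 = f (q - p).
    move: E2; do ?(case: eqP => [|_]; first by lia).
    by rewrite -fqp => ->; congr m'; lia.
  split; first by apply: ltB; lia.
  one_step; rewrite m'23 in E3; split; first by apply: ltB; lia.
  one_step; first by rewrite /upd /=; apply: ltB; lia.
  have v4E : v4 = f q.
    move: E4; do ?(case: eqP => [|_]; first by lia).
    by rewrite -fq => ->; congr m'; lia.
  split; first by apply: ltB; lia.
  have v0E : v0 = AB + q by lia.
  have impE : improves f l h w p q = (v3 < v4) by rewrite /improves lq E3 v2E v4E.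
  set m3 := upd (upd (upd _ _ _) _ _) _ _.
  have [e26 e27 e28 e30] : [/\ m3 26 = q, m3 27 = AB + q, m3 28 = v3 & m3 30 = v4].
    by split; rewrite /m3 /upd /=; lia.
  have [e0 e23 e24 e25] : [/\ m3 0 = m' 0, m3 23 = w, m3 24 = p & m3 25 = l].
    by split.
  have earr x : m3 (AB + x) = m' (AB + x) by rewrite /m3 !upd_high //; lia.
  have kp3 : keeps m m3 by do 6 apply: keeps_reg => //.
  move: m3 e26 e27 e28 e30 e0 e23 e24 e25 earr kp3.
  move=> m3 e26 e27 e28 e30 e0 e23 e24 e25 earr kp3.
  have qj : h.+1 - j.+1 = q by rewrite /q subSS.
  (* The three paths through the body, no improvement, improvement, and improvement with a new best
     profit, end in this common check. *)
  have fin m4 : keeps m m4 ->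
      [/\ m4 23 = w, m4 24 = p, m4 25 = l & m4 26 = q] ->
      (forall x, x < SZ -> m4 (AB + x) =
        if (x == q) && improves f l h w p q then v3 else m' (AB + x)) ->
      m4 0 = (if improves f l h w p q then maxn (m' 0) q else m' 0) ->
    [/\ keeps m m4, t = t,
        [/\ m4 23 = w, m4 24 = p, m4 25 = l & m4 26 = h.+1 - j.+1],
        forall x, x < SZ -> m4 (AB + x) =
          if (h.+1 - j.+1 <= x) && improves f l h w p x then f (x - p) + w else f x
      & [/\ m 0 <= m4 0,
            forall x, h.+1 - j.+1 <= x -> improves f l h w p x -> x <= m4 0
          & m4 0 = m 0 \/ improves f l h w p (m4 0)]].
    move=> kp4 rs arr4 m40; rewrite qj; split=> // [x lt|].
      rewrite arr4 //; case: (eqVneq x q) => [->|ne] /=.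
        by rewrite leqnn /= fq; case: ifP => // _; rewrite E3 v2E.
      by rewrite arr // [q <= x]leq_eqVlt eq_sym (negbTE ne).
    rewrite m40; case: ifP => im; split=> //; try lia.
    - move=> x; rewrite leq_eqVlt => /predU1P[<- _|lt /(imp _ lt)]; lia.
    - by case: (leqP (m' 0) q) => _; [right | ].
    - by move=> x; rewrite leq_eqVlt => /predU1P[<-|lt /(imp _ lt) //]; rewrite im.
  apply: wp_if; rewrite e28 e30 -?impE => cmp.
    apply: wp_seq; apply: wp_store; rewrite ?e27 ?e28; try (apply: ltB; lia).
    have low x : x < 64 -> upd m3 (AB + q) v3 x = m3 x by move=> h1; rewrite upd_low //; lia.
    have kp4 : keeps m (upd m3 (AB + q) v3) by apply: keeps_heap => //; lia.
    have arr4 x : upd m3 (AB + q) v3 (AB + x) = if x == q then v3 else m' (AB + x).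
      by rewrite /upd eqn_add2l; case: ifP.
    move: (upd m3 _ _) low kp4 arr4 => m4 low kp4 arr4.
    apply: wp_if => cmp2; rewrite !low // e0 e26 in cmp2.
      have lay4 : layout m4 by case: kp4 => -[].
      one_step; rewrite low // e26 (lay14 lay4) addn0 in E5.
      split; first by apply: ltB; lia.
      split=> //; apply: fin.
      + exact: keeps_reg.
      + by split; rewrite upd_ne // low.
      + by move=> x lt; rewrite upd_high ?arr4 ?cmp ?andbT //; lia.
      + by rewrite upd_eq cmp; lia.
    split=> //; apply: fin => //.
    + by split; rewrite low.
    + by move=> x lt; rewrite arr4 cmp andbT.
    + by rewrite low // e0 cmp; lia.
  have ni : improves f l h w p q = false by rewrite impE ltnNge cmp.
  split=> //; apply: fin => //; last by rewrite ni.
  by move=> x lt; rewrite ni andbF.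
- by move=> m' t' [_ _ [_ _ -> ->] _ _]; lia.
move=> m' t' k [kp tt _ arr [h1 h2 h3]] /wp_cost le; split=> //; first by lia.
  move=> q lt; rewrite arr //; case: (boolP (improves _ _ _ _ _ _)); rewrite ?andbF //.
  by case/andP=> /andP[lq _] _; rewrite ifT //; lia.
split=> // q im; apply: h2 => //.
by case/andP: im => /andP[lq _] _; lia.
Qed.

Let psum_SZ (S : {set 'I_n}) : psum S < SZ.
Proof. by have := psum_le S; rewrite -pmE -UE; lia. Qed.

Let OPT_U : OPT W items <= U.
Proof. by rewrite UE pmE; exact: OPT_le. Qed.

Lemma keeps_trans m m' m'' : keeps m m' -> keeps m' m'' -> keeps m m''.
Proof. by move=> [_ k1] [e2 k2]; split=> // x hx; rewrite k2 ?k1. Qed.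

Lemma wp_row m t (i : 'I_n) lo hi (target : {set 'I_n} -> Prop) b0 proc :
  env m -> m 18 = lo -> m 19 = hi -> m 20 = i -> lo < G -> hi < SZ ->
  dp_inv W target b0 SZ proc (fun p => m (AB + p)) (m 0) -> i \notin proc ->
  (forall S, target S -> i \in S -> lo <= psum (S :&: (i |: proc)) <= hi) ->
  wp B row (fun m' t' k =>
    [/\ keeps m m', t' = t, k <= 12 * (hi.+1 - lo) + 12 &
        dp_inv W target b0 SZ (i |: proc) (fun p => m' (AB + p)) (m' 0)]) m t.
Proof.
move=> em m18 m19 m20 loG hS inv ni win; have lay := env_layout em.
have := ltn_ord i; have hw := layw lay (ltn_ord i); have hp := layp lay (ltn_ord i) => lti.
have wi := wE i; have pi := pE i.
have m0U : m 0 <= U by apply: leq_trans OPT_U; case: inv.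
rewrite /row.
one_step; rewrite m20 in E; split; first by apply: ltB; lia.
one_step; rewrite (lay2 lay) in E0; split; first by apply: ltB; lia.
one_step; rewrite (lay1 lay) in E1; split; first by apply: ltB; lia.
one_step; first by rewrite /upd /=; apply: ltB; lia.
have v2E : v2 = item_w items i.
  move: E2; do ?(case: eqP => [|_]; first by lia).
  by rewrite -hw => ->; congr m; lia.
split; first by apply: ltB; lia.
one_step; rewrite (lay1 lay) in E3; split; first by apply: ltB; lia.
one_step; first by rewrite /upd /=; apply: ltB; lia.
have v4E : v4 = item_p items i.
  move: E4; do ?(case: eqP => [|_]; first by lia).
  by rewrite -hp => ->; congr m; lia.
split; first by apply: ltB; lia.
set m2 := upd _ _ _.
have kp2 : keeps m m2 by do 6 apply: keeps_reg => //; split.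
have h2 x : 64 <= x -> m2 x = m x by move=> h; rewrite /m2 !upd_high.
have [e0 e23 e24] : [/\ m2 0 = m 0, m2 23 = item_w items i & m2 24 = item_p items i].
  by split.
move: m2 kp2 h2 e0 e23 e24 => m2 kp2 h2 e0 e23 e24.
have [em2 k2] := kp2; have lay2' := env_layout em2.
have e18 : m2 18 = lo by rewrite k2. have e19 : m2 19 = hi by rewrite k2.
one_step; rewrite e18 (lay14 lay2') in E5; split; first by apply: ltB; lia.
(* Both outcomes of the comparison leave the maximum of [lo] and the profit in register 25, so the
   continuation is proved once. *)
have fin m3 : keeps m m3 -> (forall x, 64 <= x -> m3 x = m x) ->
    [/\ m3 0 = m 0, m3 23 = item_w items i, m3 24 = item_p items i &
        m3 25 = maxn lo (item_p items i)] ->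
    wp B (IAdd 26 19 1 ;; row_loop) (fun m' t' k => [/\ keeps m m', t' = t,
      k <= 12 * (hi.+1 - lo) + 3 &
      dp_inv W target b0 SZ (i |: proc) (fun p => m' (AB + p)) (m' 0)]) m3 t.
  move=> kp3 h3 [f0 f23 f24 f25]; have [em3 k3] := kp3.
  have f19 : m3 19 = hi by rewrite k3.
  one_step; rewrite f19 (lay1 (env_layout em3)) in E6; split; first by apply: ltB; lia.
  have f26 : upd m3 26 v6 26 = hi.+1 by rewrite upd_eq; lia.
  have kp4 : keeps m (upd m3 26 v6) by exact: keeps_reg.
  have h4 q : upd m3 26 v6 (AB + q) = m (AB + q) by rewrite upd_high ?h3 //; lia.
  have [r0 r23 r24 r25] : [/\ upd m3 26 v6 0 = m 0, upd m3 26 v6 23 = item_w items i,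
    upd m3 26 v6 24 = item_p items i & upd m3 26 v6 25 = maxn lo (item_p items i)] by split.
  move: (upd m3 26 v6) f26 kp4 h4 r0 r23 r24 r25 => m4 f26 kp4 h4 r0 r23 r24 r25.
  cbv beta.
  apply: (wp_mono (wp_row_loop t (proj1 kp4) r23 r24 r25 f26 hS _ wi _ _)).
  - exact: leq_maxr.
  - by rewrite r0; lia.
  - by move=> q lt; rewrite h4; case: inv => + _ _ _ _ _; apply.
  move=> m5 t5 k5 [kp5 -> le5 arr5 [b1 b2 b3]]; split=> //.
  - exact: keeps_trans kp5.
  - by lia.
  have impE q : improves (fun q => m4 (AB + q)) (maxn lo (item_p items i)) hi
      (item_w items i) (item_p items i) q =
    improves (fun q => m (AB + q)) (maxn lo (item_p items i)) hi
      (item_w items i) (item_p items i) q by rewrite /improves !h4.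
  apply: (dp_inv_item (lo := lo) inv ni hS psum_SZ win).
  - by move=> q lt; rewrite arr5 // impE !h4.
  - by rewrite -r0.
  - by move=> q; rewrite -impE; exact: b2.
  - by rewrite -r0 -impE.
have fin' m3 k0 : k0 <= 9 -> keeps m m3 -> (forall x, 64 <= x -> m3 x = m x) ->
    [/\ m3 0 = m 0, m3 23 = item_w items i, m3 24 = item_p items i &
        m3 25 = maxn lo (item_p items i)] ->
    wp B (IAdd 26 19 1 ;; row_loop) (fun m' t' k => [/\ keeps m m', t' = t,
      k0 + k <= 12 * (hi.+1 - lo) + 12 &
      dp_inv W target b0 SZ (i |: proc) (fun p => m' (AB + p)) (m' 0)]) m3 t.
  move=> le0 k3 h3 r3; apply: (wp_mono (fin m3 k3 h3 r3)) => m' t' k [? ? ? ?].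
  by split=> //; lia.
apply: wp_seq; apply: wp_if; rewrite {1 2}/upd /= => cmp.
  one_step; rewrite e24 (lay14 lay2') in E6; split; first by apply: ltB; lia.
  apply: (wp_mono (fin' (upd (upd m2 25 v5) 25 v6) 9 _ _ _ _)) => //.
  - by do 2 apply: keeps_reg => //.
  - by move=> x hx; rewrite !upd_high // h2.
  - by split; rewrite /upd //=; lia.
apply: (wp_mono (fin' (upd m2 25 v5) 9 _ _ _ _)) => //.
- by apply: keeps_reg => //.
- by move=> x hx; rewrite !upd_high // h2.
- by split; rewrite /upd //=; lia.
Qed.

(** * Buckets, rounds and the search *)

Notation key := (tape_key mm tape).

Let key_M i : key i < M.
Proof.
rewrite ME /tape_key; apply: leq_trans (bits_lt _ _) _; rewrite mul1n leq_exp2l //.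
by rewrite size_take; case: ifP => //; lia.
Qed.

(** For a set of total profit [V], the ends are its expected profits before and after bucket [k],
    widened by [D]. *)
Definition win_lo (V k : nat) := V * k %/ M - D.
Definition win_hi (V k : nat) := V * k.+1 %/ M + D.

Let M0 : 0 < M. Proof. by rewrite ME expn_gt0. Qed.

Lemma win_hi_SZ V k : V <= U + s0 -> k < M -> win_hi V k < SZ.
Proof.
move=> VU kM; suff : V * k.+1 %/ M <= V by rewrite /win_hi; lia.
by rewrite -[leqRHS](mulnK V M0) leq_div2r // leq_mul2l kM orbT.
Qed.

(** At most 12 steps per position and 12 for the setup; the summand 3 covers the rounding of the
    quotients and the inclusive upper end. *)
Definition row_cost := 12 * ((U + s0) %/ M + 2 * D + 3) + 12.

Lemma win_size V k : V <= U + s0 ->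
  12 * ((win_hi V k).+1 - win_lo V k) + 12 <= row_cost.
Proof.
move=> VU; rewrite /row_cost /win_hi /win_lo mulnS.
have h1 : V %/ M <= (U + s0) %/ M by exact: leq_div2r.
have h2 : (V + V * k) %/ M <= V %/ M + V * k %/ M + 1.
  by rewrite divnD // leq_add2l; exact: leq_b1.
move: h1 h2; move: ((V + _) %/ M) (V * k %/ M) (V %/ M) (_ %/ M) => *; lia.
Qed.

Lemma wp_bucket m t k V b0 :
  let target : {set 'I_n} -> Prop := fits key (win_lo V) (win_hi V) M in
  env m -> keyed m n -> m 16 = V -> m 17 = k -> k < M -> V <= U + s0 ->
  dp_inv W target b0 SZ (proc_set items key k 0) (fun p => m (AB + p)) (m 0) ->
  wp B bucket (fun m' t' c =>
    [/\ env m', keyed m' n, [/\ m' 8 = m 8, m' 16 = V & m' 17 = k.+1], t' = t &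
     dp_inv W target b0 SZ (proc_set items key k.+1 0) (fun p => m' (AB + p)) (m' 0) /\
     c <= \sum_(i < n) (8 + (key i == k) * row_cost + 2) + 11]) m t.
Proof.
move=> target em km m16 m17 kM VU inv; have lay := env_layout em.
have hiS := win_hi_SZ VU kM; have VG : V < G by lia.
have loV : V * k %/ M <= V * k by exact: leq_div.
have VkB : V * k < B by apply: ltBB; lia.
have VkSB : V * k.+1 < B by apply: ltBB; lia.
have loG : win_lo V k < G.
  rewrite /win_lo; apply: leq_ltn_trans (leq_subr _ _) _; apply: leq_ltn_trans VG.
  by rewrite -[leqRHS](mulnK V M0) leq_div2r // leq_mul2l ltnW ?orbT.
rewrite /bucket.
one_step; rewrite m16 m17 in E; split; first by lia.
one_step; rewrite (env6 em) in E0; split; first by apply: leq_ltn_trans VkB; rewrite E0 E.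
one_step; rewrite (env10 em) E0 E -/(win_lo V k) in E1; split; first by apply: ltB; lia.
one_step; rewrite m17 (lay1 lay) in E2; split; first by apply: ltB; lia.
one_step; rewrite m16 E2 addn1 in E3; split; first by lia.
one_step; rewrite (env6 em) in E4; split.
  by apply: leq_ltn_trans VkSB; rewrite E4 E3; exact: leq_div.
one_step; rewrite (env10 em) E4 E3 -/(win_hi V k) in E5; split; first by apply: ltB; lia.
one_step.
apply: wp_seq; apply: (wp_while (N := n) (cost := fun i => 8 + (key i == k) * row_cost)
  (I := fun i m' t' =>
  [/\ env m', keyed m' n, [/\ m' 8 = m 8, m' 16 = V & m' 17 = k],
      [/\ m' 18 = win_lo V k, m' 19 = win_hi V k, m' 20 = i & t' = t] &
      dp_inv W target b0 SZ (proc_set items key k i) (fun p => m' (AB + p)) (m' 0)])).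
- split.
  + by do 8 apply: env_reg => //.
  + by do 8 apply: keyed_reg => //.
  + by split.
  + by split; rewrite /upd /=.
  + rewrite (_ : upd _ 20 _ 0 = m 0) //.
    apply: eq_dp_inv (_ : dp_inv W target b0 SZ _ (fun p => m (AB + p)) _).
      by move=> p; rewrite !upd_high //; lia.
    exact: inv.
- move=> i m' t' lti [em' km' [r8 r16 r17] [r18 r19 r20 ->] inv'].
  clear E E0 E1 E2 E3 E4 E5 loV VkB VkSB.
  have lay' := env_layout em'; have kM' := key_M i; have kiE := km' i lti.
  rewrite r20 (lay4 lay'); split=> //.
  one_step; rewrite (env11 em') r20 in E; split; first by apply: ltB; lia.
  one_step; first by rewrite /upd /=; apply: ltB; lia.
  have v8E : v8 = key i.
    move: E0; do ?(case: eqP => [|_]; first by lia).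
    by rewrite -kiE => ->; congr m'.
  split; first by apply: ltB; lia.
  one_step; rewrite r17 in E1; split; first by apply: ltB; lia.
  one_step; rewrite r17 in E2; split; first by apply: ltB; lia.
  one_step; split; first by apply: ltB; lia.
  set m2 := upd _ _ _.
  have kp2 : keeps m' m2 by do 5 apply: keeps_reg => //; split.
  have h2 x : 64 <= x -> m2 x = m' x by move=> h; rewrite /m2 !upd_high.
  have e0 : m2 0 = m' 0 by [].
  have e21 : m2 21 = (key i - k) + (k - key i) by rewrite /m2 /upd /=; lia.
  move: m2 kp2 h2 e0 e21 => m2 kp2 h2 e0 e21.
  have inv2 : dp_inv W target b0 SZ (proc_set items key k i) (fun p => m2 (AB + p)) (m2 0).
    rewrite e0; apply: eq_dp_inv inv' => p; rewrite h2 //; lia.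
  have [em2 kr2] := kp2.
  apply: wp_seq; apply: wp_if; rewrite e21 (lay1 (env_layout em2)) => cmp.
    have kE : key i = k by lia.
    rewrite kE eqxx mul1n; pose io := Ordinal lti.
    have n2 : io \notin proc_set items key k i by exact: (@proc_set_notin items key k io).
    have win S : target S -> io \in S ->
        win_lo V k <= psum (S :&: (io |: proc_set items key k i)) <= win_hi V k.
      by move=> tS _; exact: (fits_window (i := io) tS kM).
    have e18 : m2 18 = win_lo V k by rewrite kr2. have e19 : m2 19 = win_hi V k by rewrite kr2.
    have e20 : m2 20 = io by rewrite kr2.
    apply: (wp_mono (wp_row t em2 e18 e19 e20 loG hiS inv2 n2 win)).
    move=> m3 t3 k3 [kp3 -> le3 inv3].
    have [em3 kr3] := keeps_trans kp2 kp3.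
    have le4 := leq_trans le3 (win_size k VU).
    one_step; rewrite (lay1 (env_layout em3)) kr3 // r20 addn1 in E4.
    split; first by apply: ltB; lia.
    split; last by lia.
    split.
    + exact: env_reg.
    + by apply: keyed_reg => // j ltj; rewrite kr3 ?km' //; lia.
    + by split; rewrite /upd /= kr3.
    + by split; rewrite /upd /= ?E4 ?kr3.
    rewrite (_ : upd _ 20 _ 0 = m3 0) //.
    apply: eq_dp_inv (_ : dp_inv W target b0 SZ _ (fun p => m3 (AB + p)) _).
      by move=> p; rewrite !upd_high //; lia.
    by rewrite (@proc_set_take items key k io).
  have kE : key i != k by lia.
  one_step; rewrite (lay1 (env_layout em2)) kr2 // r20 addn1 in E4.
  split; first by apply: ltB; lia.
  split; last by lia.
  split.
  + exact: env_reg.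
  + by apply: keyed_reg => // j ltj; rewrite kr2 ?km' //; lia.
  + by split; rewrite /upd /= kr2.
  + by split; rewrite /upd /= ?E4 ?kr2.
  rewrite (_ : upd _ 20 _ 0 = m2 0) //.
  apply: eq_dp_inv (_ : dp_inv W target b0 SZ _ (fun p => m2 (AB + p)) _).
    by move=> p; rewrite !upd_high //; lia.
  by rewrite (@proc_set_skip items key k (Ordinal lti)).
- by move=> m' t' [em' _ _ [_ _ -> _] _]; rewrite (lay4 (env_layout em')).
move=> m' t' c [em' km' [r8 r16 r17] [_ _ _ ->] inv'] le.
one_step; rewrite r17 (lay1 (env_layout em')) addn1 in E7.
split; first by apply: ltB; lia.
split=> //; [exact: env_reg | exact: keyed_reg |].
split; last by lia.
rewrite (_ : upd _ 17 _ 0 = m' 0) //.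
apply: eq_dp_inv (_ : dp_inv W target b0 SZ _ (fun p => m' (AB + p)) _).
  by move=> p; rewrite !upd_high //; lia.
by rewrite -proc_set_bucket.
Qed.

Definition good_keys : Prop := forall V, 0 < V <= OPT W items ->
  exists S : {set 'I_n}, [/\ fits key (win_lo V) (win_hi V) M S, wsum S <= W &
    V <= psum S].

Definition round_cost := 5 * SZ + M * (10 * n + 13) + n * row_cost + 9.

(** Exchanging the sums charges [row_cost] once per item, since an item has a single key; only the
    cheap scan of the items is repeated in all [M] buckets. *)
Let bucket_costs :
  \sum_(k < M) (\sum_(i < n) (8 + (key i == k) * row_cost + 2) + 11 + 2) =
  M * (10 * n + 13) + n * row_cost.
Proof.
rewrite (eq_bigr (fun k : 'I_M => (10 * n + 13) + \sum_(i < n) (key i == k) * row_cost)).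
  rewrite big_split /= sum_nat_const card_ord; congr (_ + _).
  rewrite exchange_big /= (eq_bigr (fun=> row_cost)) ?sum_nat_const ?card_ord // => i _.
  rewrite (bigD1 (Ordinal (key_M i))) //= eqxx mul1n big1 ?addn0 // => k ne.
  by rewrite eq_sym -val_eqE /= in ne; rewrite (negbTE ne).
move=> k _; rewrite (eq_bigr (fun i : 'I_n => 10 + (key i == k) * row_cost)).
  by rewrite big_split /= sum_nat_const card_ord; lia.
by move=> i _; rewrite -addnA [_ * _ + _]addnC addnA.
Qed.

(** The bound by OPT comes from soundness and holds for all keys; good keys are needed only for
    progress to [m 0 + s]. *)
Lemma wp_round m t s : env m -> keyed m n -> m 8 = s -> 0 < s <= s0 ->
  m 0 <= OPT W items ->
  wp B round (fun m' t' c =>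
    [/\ env m', keyed m' n, m' 8 = s %/ 2, m 0 <= m' 0 <= OPT W items &
      (good_keys -> m 0 + s <= OPT W items -> m 0 + s <= m' 0) /\
      (t' = t /\ c <= round_cost)]) m t.
Proof.
move=> em km m8 /andP[s1 ss0] m0O; have lay := env_layout em.
have m0U := leq_trans m0O OPT_U; rewrite /round.
pose V := m 0 + s; have VU : V <= U + s0 by rewrite /V; lia.
one_step; rewrite m8 -/V in E; split; first by apply: ltB; lia.
one_step.
apply: wp_seq; apply: (wp_while (N := SZ) (cost := fun=> 3) (I := fun j m' t' =>
  [/\ env m', keyed m' n, [/\ m' 8 = s, m' 16 = V, m' 0 = m 0 & m' 26 = j],
    t' = t & forall q, q < j -> m' (AB + q) = W.+1])).
- split=> //.
  + by do 2 apply: env_reg => //.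
  + by do 2 apply: keyed_reg => //.
- move=> j m' t' ltj [em' km' [r8 r16 r0 r26] -> fW]; have lay' := env_layout em'.
  rewrite r26 (env13 em'); split=> //.
  one_step; rewrite (env12 em') r26 in E1; split; first by apply: ltB; lia.
  apply: wp_seq; apply: wp_store; rewrite /upd /= ?(env31 em'); try (apply: ltB; lia).
  rewrite -/(upd m' 27 v1) -/(upd _ v1 W.+1).
  have em2 : env (upd (upd m' 27 v1) v1 W.+1).
    by apply: env_heap; [lia | exact: env_reg].
  have low x : x < 64 -> x != 27 -> upd (upd m' 27 v1) v1 W.+1 x = m' x.
    by move=> lx nx; rewrite upd_low ?upd_ne //; lia.
  have hx x : 64 <= x -> x != v1 -> upd (upd m' 27 v1) v1 W.+1 x = m' x.
    by move=> lx nx; rewrite upd_ne ?upd_high.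
  have hv : upd (upd m' 27 v1) v1 W.+1 v1 = W.+1 by rewrite upd_eq.
  move: (upd _ v1 _) em2 low hx hv => m2 em2 low hx hv.
  one_step; rewrite low // r26 (lay1 (env_layout em2)) addn1 in E2.
  split; first by apply: ltB; lia.
  split=> //; split=> //.
  + exact: env_reg.
  + by apply: keyed_reg => // i lti; rewrite hx ?km' //; lia.
  + by split; rewrite /upd /= ?low.
  move=> q ltq; rewrite upd_high //; last by lia.
  case: (eqVneq (AB + q) v1) => [-> // | ne].
  by rewrite hx ?fW //; lia.
- by move=> m' t' [em' _ [_ _ _ ->] _ _]; rewrite (env13 em').
move=> m1 t1 k1 [em1 km1 [r8 r16 r0 r26] -> fW] /wp_cost le1.
cbv beta; apply: wp_seq; apply: wp_store;
  rewrite ?(env12 em1) ?(lay14 (env_layout em1)); try (apply: ltB; lia).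
have em2 : env (upd m1 AB 0) by apply: env_heap => //; lia.
have low x : x < 64 -> upd m1 AB 0 x = m1 x by move=> lx; rewrite upd_low //; lia.
have km2 : keyed (upd m1 AB 0) n by move=> i lti; rewrite upd_ne ?km1 //; lia.
have f0 : upd m1 AB 0 (AB + 0) = 0 by rewrite addn0 upd_eq.
have fS p : 0 < p < SZ -> upd m1 AB 0 (AB + p) = W.+1.
  by move=> lp; rewrite upd_ne ?fW //; lia.
move: (upd m1 AB 0) em2 low km2 f0 fS => m2 em2 low km2 f0 fS.
one_step.
pose target : {set 'I_n} -> Prop := fits key (win_lo V) (win_hi V) M.
apply: wp_seq; apply: (wp_while (N := M)
  (cost := fun k => \sum_(i < n) (8 + (key i == k) * row_cost + 2) + 11)
  (I := fun k m' t' =>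
    [/\ env m', keyed m' n, [/\ m' 8 = s, m' 16 = V & m' 17 = k], t' = t &
     dp_inv W target (m 0) SZ (proc_set items key k 0) (fun p => m' (AB + p)) (m' 0)])).
- split=> //.
  + exact: env_reg.
  + exact: keyed_reg.
  + by split; rewrite /upd /= ?low.
  rewrite (_ : upd _ 17 _ 0 = m 0); last by rewrite /upd /= low.
  rewrite proc_set_start; apply: dp_inv_init => //; first by lia.
    by rewrite upd_high //; lia.
  by move=> p lp; rewrite upd_high ?fS //; lia.
- move=> k m' t' ltk [em' km' [q8 q16 q17] -> inv']; rewrite q17 (env6 em'); split=> //.
  apply: (wp_mono (wp_bucket t em' km' q16 q17 ltk VU inv')).
  by move=> m3 t3 c3 [em3 km3 [p8 p16 p17] -> [inv3 le3]]; rewrite p8.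
- by move=> m' t' [em' _ [_ _ ->] _ _]; rewrite (env6 em').
move=> m3 t3 k3 [em3 km3 [q8 q16 q17] -> inv3]; rewrite bucket_costs => le3.
have inv4 := inv3; rewrite proc_set_end in inv4; last by move=> i _; exact: key_M.
one_step; rewrite q8 (lay15 (env_layout em3)) in E2; split.
  by apply: ltB; apply: leq_ltn_trans (_ : s < _); rewrite ?E2 ?leq_div //; lia.
split.
- exact: env_reg.
- exact: keyed_reg.
- by rewrite /upd /=.
- by rewrite upd_ne //; case: inv3 => _ _ _ -> ->.
split=> [good le|]; last by split=> //; rewrite /round_cost; lia.
rewrite upd_ne // -/V; have [|S [tS wS pS]] := good V; first by rewrite /V in le *; lia.
apply: (dp_inv_final inv4 psum_SZ tS wS); rewrite pS andbT /V; lia.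
Qed.

(** On good keys OPT stays below the best profit plus twice the current step: a target within reach
    raises the best profit by the step, and a target beyond OPT gives the halved bound at once.
    After [e.+1] rounds the gap is below 1. *)
Lemma wp_search m t : env m -> keyed m n -> m 8 = s0 ->
  wp B search (fun m' _ c =>
    (good_keys -> m' 0 = OPT W items) /\ c <= e.+1 * (round_cost + 2) + 3) m t.
Proof.
move=> em km m8; rewrite /search; one_step.
apply: (wp_while (N := e.+1) (cost := fun=> round_cost) (I := fun j m' t' =>
  [/\ env m', keyed m' n, m' 8 = s0 %/ 2 ^ j, m' 0 <= OPT W items &
    good_keys -> OPT W items < m' 0 + 2 ^ (e.+1 - j)])).
- split.
  + exact: env_reg.
  + exact: keyed_reg.
  + by rewrite /upd /= m8 expn0 divn1.
  + by rewrite /upd /= E.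
  move=> _; rewrite /upd /= E subn0; apply: leq_ltn_trans OPT_U _.
  have : U < 2 ^ e by rewrite eE; exact: (@up_logP 2).
  by rewrite expnS; lia.
- move=> j m' t' ltj [em' km' r8 rO rg].
  have sE : s0 %/ 2 ^ j = 2 ^ (e - j) by rewrite s0E expnB.
  have le0 : 2 ^ (e - j) <= s0 by rewrite s0E leq_exp2l // leq_subr.
  rewrite r8 sE (lay14 (env_layout em')) expn_gt0; split=> //.
  rewrite sE in r8.
  apply: (wp_mono (wp_round t' em' km' r8 _ rO)); first by rewrite expn_gt0.
  move=> m2 t2 c2 [em2 km2 q8 /andP[q0 qO] [qg [_ le]]]; split=> //; split=> //.
    by rewrite q8 -sE -divnMA expnSr.
  move=> good; rewrite subSS; have := qg good; have := rg good.
  rewrite subSn // expnS; case: (leqP (m' 0 + 2 ^ (e - j)) (OPT W items)); lia.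
- move=> m' t' [em' _ r8 _ _]; rewrite r8 (lay14 (env_layout em')) s0E.
  by rewrite divn_small // ltn_exp2l.
move=> m' t' k [_ _ _ rO rg] /wp_cost le; split; last by lia.
by move=> /rg; rewrite subnn expn0 addn1 ltnS => h; apply/eqP; rewrite eqn_leq rO.
Qed.

Definition total_cost := 24 * n + 5 * mm + 4 * e + 150 +
  (n * (6 * mm + 9) + 3) + (e.+1 * (round_cost + 2) + 3).

Lemma wp_knapsack :
  wp B knapsack (fun m' _ c =>
    (good_keys -> m' 0 = OPT W items) /\ c <= total_cost) (init_mem W items) tape.
Proof.
rewrite /knapsack; apply: wp_seq.
apply: (wp_mono (wp_prologue tape)) => m1 t1 k1 [lay1' -> le1]; apply: wp_seq.
apply: (wp_mono (wp_compute_pmax tape lay1')) => m2 t2 k2 [lay2' m25 -> le2]; apply: wp_seq.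
apply: (wp_mono (wp_compute_buckets tape lay2')) => m3 t3 k3 [lay3' [m35 m36 m37] -> le3].
rewrite m25 in m35; apply: wp_seq.
apply: (wp_mono (wp_compute_step tape lay3' m35)) => m4 t4 k4.
move=> [lay4' [m45 m46 m47] [m48 m49 m432] -> le4].
rewrite m36 in m46; rewrite m37 in m47; apply: wp_seq.
apply: (wp_mono (wp_compute_bases tape lay4' m45 m46 m47 m49 m48 m432)).
move=> m5 t5 k5 [em5 m58 -> le5]; apply: wp_seq.
apply: (wp_mono (wp_draw_keys em5 m58)) => m6 t6 k6 [em6 km6 m68 le6].
apply: (wp_mono (wp_search t6 em6 km6 m68)) => m7 t7 k7 [good le7]; split=> //.
by rewrite /total_cost; lia.
Qed.

End Correctness.

(** * Resource bounds *)

(** For [n > 1], minimality of the power of two says that its half has a square below [n]. *)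
Lemma up_log4_bound n : 0 < n -> (2 ^ up_log 4 n <= 2 * (Nat.sqrt n).+1) /\
  2 ^ up_log 4 n <= 2 * n.
Proof.
move=> n0; case: (leqP n 1) => [n1|n1].
  by have -> : n = 1 by lia.
have := up_log_gtn (isT : 1 < 4) n1; have : 0 < up_log 4 n by rewrite up_log_gt0 n1.
case: (up_log 4 n) => // m _; rewrite succnK (expnMn 2 2) => lt.
have := PeanoNat.Nat.sqrt_spec n; have x0 : 0 < 2 ^ m by rewrite expn_gt0.
rewrite expnS; move: (Nat.sqrt n) (2 ^ m) x0 lt => r x x0 lt sp.
split; last by nia.
have [|_ ltr] := sp; first by lia.
by rewrite leq_mul2l /=; nia.
Qed.

Lemma up_log2_bound U : 2 ^ up_log 2 U.+1 <= 2 * U + 1.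
Proof.
case: U => [//|U]; have U1 : 1 < U.+2 by [].
have := up_log_gtn (isT : 1 < 2) U1; have : 0 < up_log 2 U.+2 by rewrite up_log_gt0.
by case: (up_log 2 U.+2) => // m _; rewrite succnK expnS; lia.
Qed.

Lemma up_log2_prod_bound n p : 0 < n -> 0 < p ->
  (up_log 2 (n * p).+1).+1 <= 3 * (trunc_log 2 (n + p)).+1.
Proof.
move=> n0 p0; set l := (trunc_log 2 (n + p)).+1.
have h : n + p < 2 ^ l by exact: trunc_log_ltn.
suff : up_log 2 (n * p).+1 <= 2 * l by rewrite /l; lia.
apply: up_log_min => //; rewrite mul2n -addnn expnD.
apply: leq_trans (leq_mul (ltnW h) (ltnW h)); nia.
Qed.

Section Bounds.

Variables (W : nat) (items : seq (nat * nat)).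
Notation n := (size items).
Notation pm := (pmax items).
Notation mm := (up_log 4 n).
Notation M := (2 ^ mm).
Notation U := (n * pm).
Notation e := (up_log 2 U.+1).
Notation D := (8 * M * pm * e.+1).
Notation X := (64 * (n + W)).
Notation KB := (X + n + n + 1).
Notation AB := (KB + n).
Notation SZ := (U + 2 ^ e + D + 1).
Notation wt := (\sum_(x <- items) x.1).

Lemma word_bound_large G : G = AB + SZ + wt + W + M + 2 ^ e + pm + 64 ->
  G * G <= word_bound 200 W items.
Proof.
move=> GE; rewrite /word_bound; set N := 2 + W + n + _ + _.
have N2 : 2 <= N by rewrite /N; lia.
have pmN : pm <= \sum_(x <- items) x.2.
  rewrite /pmax; elim: items => [|x s IH]; first by rewrite !big_nil.
  by rewrite !big_cons geq_max leq_addr (leq_trans IH) ?leq_addl.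
have MN : M <= 2 * N.
  case: (posnP n) => [->|n0]; first by rewrite up_log0; lia.
  have [_ h] := up_log4_bound n0; rewrite /N; lia.
have eU := up_log2_bound U.
have UN : U <= N * N by apply: leq_mul; rewrite /N; lia.
have ltee : e < 2 ^ e by exact: ltn_expl.
have N4 : N * N * N * N = N ^ 4 by rewrite !expnS expn0; lia.
have DN : D <= 48 * N ^ 4.
  rewrite -N4; apply: leq_trans (_ : 8 * (2 * N) * N * (3 * (N * N)) <= _).
    by apply: leq_mul; [apply: leq_mul|]; [rewrite leq_mul2l MN | rewrite /N; lia | nia].
  lia.
have NN4 : N * N <= N ^ 4 by rewrite -N4; nia.
have GN : G <= 2 ^ 9 * N ^ 4.
  have -> : 2 ^ 9 = 512 by []. rewrite GE; have : N <= N * N by nia.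
  rewrite /N in NN4 N4 DN UN MN *; lia.
(* As [N >= 2], the constant [2 ^ 9] is absorbed by [N ^ 9]. *)
have GN' : G <= N ^ 13.
  by apply: leq_trans GN _; rewrite (expnD N 9 4) leq_mul2r leq_exp2r // N2 orbT.
apply: leq_trans (leq_mul GN' GN') _; rewrite -expnD leq_exp2l //.
Qed.

Lemma pmax_gt0 : valid_instance W items -> 0 < n -> 0 < pm.
Proof.
case=> _; rewrite /pmax; case: items => // x s /= /andP[/andP[_ x0] _] _.
by rewrite big_cons leq_max x0.
Qed.

Lemma total_cost_le : valid_instance W items ->
  total_cost items mm M U e (2 ^ e) D SZ < time_bound 200 items.
Proof.
rewrite /total_cost /round_cost /row_cost /time_bound.
move=> valid; case: (posnP n) => [n0|n0].
  have -> : pm = 0 by rewrite /pmax (size0nil n0) big_nil.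
  by rewrite n0 muln0 !mul0n up_log0 up_log1.
have p0 := pmax_gt0 valid n0.
have [M2S M2n] := up_log4_bound n0.
have leL := up_log2_prod_bound n0 p0.
have l2 : 2 <= (trunc_log 2 (n + pm)).+1.
  by rewrite ltnS trunc_log_gt0 /=; lia.
have eU := up_log2_bound U.
have ltmm : mm < M by exact: ltn_expl.
have nMM : n <= M * M by rewrite -(expnMn 2 2); exact: (@up_logP 4).
have M0 : 0 < M by rewrite expn_gt0.
move: (Nat.sqrt n).+1 (trunc_log 2 (n + pm)).+1 e (2 ^ e) mm M p0 M2S M2n leL l2 eU ltmm nMM M0.
move: pm n n0 => p N N0 S l e s mm M p0 M2S M2N leL l2 eU ltmm NMM M0.
have Np0 : 0 < N * p by rewrite muln_gt0 N0.
have sN : s <= 3 * (N * p) by lia.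
have NpM : N * p <= M * M * p by rewrite leq_mul2r NMM orbT.
(* This is where [N <= M * M] pays: a share [1 / M] of the profit range is of order [M * p], the
   same as the deviation up to the logarithm. *)
have divM : (N * p + s) %/ M <= 8 * (S * p).
  apply: leq_trans (_ : (4 * (M * p) * M) %/ M <= _); last first.
    by rewrite mulnK //; nia.
  by apply: leq_div2r; lia.
have Sp0 : 0 < S * p by rewrite muln_gt0 p0 andbT; lia.
have Sl0 : S * p <= S * p * l by rewrite leq_pmulr //; lia.
have DE : 8 * M * p * e.+1 <= 48 * (S * p * l).
  apply: leq_trans (_ : 8 * (2 * S) * p * (3 * l) <= _); last by lia.
  by apply: leq_mul => //; rewrite leq_mul2r; apply/orP; right; rewrite leq_mul2l M2S orbT.
move: (_ %/ M) (8 * M * p * e.+1) divM DE => q D divM DE.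
have rowE : 12 * (q + 2 * D + 3) + 12 <= 1296 * (S * p * l) by lia.
move: (12 * _ + 12) rowE => rc rowE.
(* A single round costs a constant times [A]; the number of rounds brings one more factor [l]. *)
pose A := N * (S * p * l).
have NA : N <= A by rewrite /A leq_pmulr //; lia.
have NpA : N * p <= A by rewrite /A; nia.
have DA : S * p * l <= A by rewrite /A leq_pmull.
have NSA : N * S <= A by rewrite /A; nia.
have SA : S <= A by nia.
have rcA : N * rc <= 1296 * A by rewrite /A; nia.
have MNA : M * (10 * N + 13) <= 46 * A.
  by apply: leq_trans (_ : (2 * S) * (23 * N) <= _); [apply: leq_mul; lia | lia].
have mmA : N * (6 * mm + 9) <= 21 * A.
  by apply: leq_trans (_ : N * (21 * S) <= _); [rewrite leq_mul2l; apply/orP; right; lia | lia].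
have roundA : 5 * (N * p + s + D + 1) + M * (10 * N + 13) + N * rc + 9 + 2 <= 1700 * A.
  lia.
have searchA :
    e.+1 * (5 * (N * p + s + D + 1) + M * (10 * N + 13) + N * rc + 9 + 2) <=
    51 * 100 * (A * l).
  apply: leq_trans (leq_mul leL roundA) _; lia.
have lA : l <= A * l by rewrite leq_pmull; lia.
have AlA : A <= A * l by rewrite leq_pmulr; lia.
apply: leq_ltn_trans (_ : 56 * 100 * (A * l) < _); first by lia.
rewrite mulnDr muln1 /A; apply: leq_ltn_trans (_ : 200 * (N * S * p * l ^ 200) < _); last by lia.
have -> : 56 * 100 * (N * (S * p * l) * l) = (N * S * p) * (56 * 100 * (l * l)) by lia.
have -> : 200 * (N * S * p * l ^ 200) = (N * S * p) * (200 * l ^ 200) by lia.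
rewrite leq_mul2l; apply/orP; right.
(* The constant 5600 exceeds the coefficient 200 by a factor 28, which spare powers of the logarithm
   absorb: [l >= 2] gives [l ^ 5 >= 32]. *)
have h5 : 2 ^ 5 <= l ^ 5 by rewrite leq_exp2r.
have -> : l ^ 200 = l ^ 193 * l ^ 5 * (l * l) by rewrite mulnn -!expnD.
rewrite [leqRHS]mulnA leq_mul2r; apply/orP; right.
have h193 : 0 < l ^ 193 by rewrite expn_gt0; lia.
move: (l ^ 193) (l ^ 5) h193 h5 => x y x0; rewrite (_ : 2 ^ 5 = 32) // => y0; nia.
Qed.

(** The set is fixed by the instance and [V] without looking at the keys, so its profits are
    constants in the tail bound. The default makes it total, as the union bound also runs over [V]
    above OPT. *)
Let choice (V : nat) : {set 'I_n} :=
  odflt set0 [pick S : {set 'I_n} | (wsum S <= W) && (V <= psum S <= V + pm)].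

Let choiceP V : V <= OPT W items ->
  [/\ wsum (choice V) <= W, V <= psum (choice V) & psum (choice V) <= V + pm].
Proof.
move=> /exists_near_subset[S [wS VS SV]]; rewrite /choice; case: pickP => [S' | /(_ S)].
  by case/andP=> ? /andP[].
by rewrite wS VS SV.
Qed.

Let weight (V i : nat) : nat :=
  if (insub i : option 'I_n) is Some o then
    if o \in choice V then item_p items i else 0
  else 0.

Let weightE V (o : 'I_n) :
  weight V o = if o \in choice V then item_p items o else 0.
Proof. by rewrite /weight valK. Qed.

(** [good_keys] is a proposition, so tapes are counted through a boolean event that implies it: for
    each [V], the partial profits of [choice V] stay close to their means at all thresholds. *)
Lemma good_keys_frequent T : valid_instance W items -> 0 < n -> mm * n <= T ->
  exists good : pred (seq bool),
    (forall t, good t -> good_keys W items t mm M D) /\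
    #|[pred t : T.-tuple bool | ~~ good t]| * n <= 2 ^ T.
Proof.
move=> valid n0 leT; have p0 := pmax_gt0 valid n0.
pose D0 := 7 * M * pm * e.+1.
pose good (t : seq bool) := [forall j : 'I_U.+1, forall k : 'I_M.+1,
   let s := \sum_(i < n) (if tape_key mm t i < k then weight j i else 0) in
   let tot := \sum_(i < n) weight j i in
   (M * s <= tot * k + M * D0) && (tot * k <= M * s + M * D0)].
exists good; split=> [t gt V /andP[V0 VO]|].
  have [wS VS SV] := choiceP VO; exists (choice V); split=> //.
  have VU : V < U.+1 by rewrite ltnS (leq_trans VO (OPT_le W items)).
  have totE : \sum_(i < n) weight V i = psum (choice V).
    by rewrite /psum [RHS]big_mkcond; apply: eq_bigr => i _; exact: weightE.
  have sE k : \sum_(i < n) (if tape_key mm t i < k then weight V i else 0) =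
      psum (choice V :&: proc_set items (tape_key mm t) k 0).
    rewrite /psum [RHS]big_mkcond; apply: eq_bigr => i _.
    by rewrite weightE !inE andbF orbF; case: (i \in _); case: (_ < k).
  have close k : k <= M -> let s := psum (choice V :&: proc_set items (tape_key mm t) k 0) in
      M * s <= psum (choice V) * k + M * D0 /\ psum (choice V) * k <= M * s + M * D0.
    move=> kM s; have /forallP/(_ (Ordinal VU))/forallP/(_ (Ordinal (kM : k < M.+1))) := gt.
    by rewrite /= sE totE => /andP.
  have M0 : 0 < M by rewrite expn_gt0.
  (* The 8 in [D] against the 7 in [D0]: the surplus absorbs the excess of up to [pm] of the chosen
     profit over [V], from which the windows are computed. *)
  have DD : D0 + pm <= D.
    have : pm <= M * pm * e.+1 by rewrite mulnAC leq_pmull ?muln_gt0 ?M0.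
    by rewrite /D0; lia.
  move: (psum (choice V)) VS SV close => P VS SV close k kM.
  have [_ lo] := close k (ltnW kM); have [hi _] := close k.+1 kM.
  move: (psum _) (psum _) lo hi => s s' lo hi; rewrite /win_lo /win_hi; split.
    rewrite leq_subLR addnC -[leqRHS](mulnK _ M0); apply: leq_div2r.
    apply: leq_trans (_ : P * k <= _); first by rewrite leq_mul2r VS orbT.
    by apply: leq_trans lo _; rewrite mulnDl ![M * _]mulnC leq_add2l leq_mul2r; lia.
  rewrite addnC -leq_subLR leq_divRL // mulnBl leq_subLR.
  have h1 : P * k.+1 <= V * k.+1 + pm * M.
    by apply: leq_trans (leq_mul SV (leqnn k.+1)) _; rewrite mulnDl leq_add2l leq_mul2l kM orbT.
  have h2 : (D0 + pm) * M <= D * M by rewrite leq_mul2r DD orbT.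
  rewrite mulnC; apply: leq_trans hi _; rewrite [M * D0]mulnC; lia.
have := @concentration 'I_U.+1 (fun j => weight j) mm n T pm e.+1 p0 isT _ _ leT.
have wle (j : 'I_U.+1) i : weight j i <= pm.
  rewrite /weight; case: insubP => // o _ _; case: ifP => // _; exact: item_p_le_pmax.
have nMM : n <= M * M by rewrite -(expnMn 2 2); exact: (@up_logP 4).
move=> /(_ wle nMM); rewrite -/D0 -/good card_ord.
set bad := #|_|; set Y := _ * 2 => le.
have Y0 : 0 < Y by rewrite !muln_gt0.
have eU : U.+1 <= 2 ^ e by exact: (@up_logP 2).
have ne : n <= 2 ^ e by apply: leq_trans (ltnW eU); rewrite leq_pmulr.
have [_ M2n] := up_log4_bound n0.
(* The factors [n], [U.+1] and [M.+1] are each of order [2 ^ e]; this is why the tail bound was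
   taken with exponent [3 * L]. *)
have nY : n * Y <= 2 ^ (3 * e.+1).
  have -> : 2 ^ (3 * e.+1) = 2 ^ e * (2 ^ e * (4 * 2 ^ e) * 2).
    by rewrite mulnC expnM !expnS expn0; lia.
  by apply: leq_mul => //; apply: leq_mul => //; apply: leq_mul => //; lia.
rewrite -(leq_pmul2r Y0); apply: leq_trans le.
by rewrite -mulnA leq_mul2l nY orbT.
Qed.

End Bounds.

Theorem theorem2 :
  exists (P : program) (c d : nat), 0 < d /\
    forall (W : nat) (items : seq (nat * nat)),
      valid_instance W items ->
      let B := word_bound c W items in
      let T := time_bound c items in
      (* halts within T steps on every random tape *)
      (forall r : T.-tuple bool, output B P T W items r != None) /\
      (* outputs OPT with probability >= 1 - 1/n^d over uniform tapes *)
      #|[pred r : T.-tuple bool | output B P T W items r != Some (OPT W items)]|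
        * size items ^ d <= 2 ^ T.
Proof.
exists (code 0 knapsack ++ [:: IHalt]), 200, 1; split=> // W items valid B T.
have [W0 _] := valid; set n := size items; set mm := up_log 4 n.
have cost := total_cost_le valid; rewrite -/T in cost.
have leT : mm * n <= T by apply: leq_trans (ltnW cost); rewrite /total_cost -/n -/mm; lia.
have runs (r : T.-tuple bool) :
    exists2 o, output B (code 0 knapsack ++ [:: IHalt]) T W items r = Some o &
    good_keys W items r mm (2 ^ mm)
      (8 * 2 ^ mm * pmax items * (up_log 2 (n * pmax items).+1).+1) ->
    o = OPT W items.
  have sz : mm * n <= size r by rewrite size_tuple.
  have w := @wp_knapsack W items r B _ _ _ _ _ _ _ _ _ _ _ _ _ erefl erefl erefl
    erefl erefl erefl erefl erefl erefl erefl erefl erefl erefl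
    (word_bound_large erefl) W0 sz.
  have [|m' [t' [k [[good _] rE]]]] := run_wp (fuel := T) w.
    by move=> m' t' k [_ le]; exact: leq_ltn_trans le cost.
  by exists (m' 0) => //; rewrite /output /init_config rE.
split=> [r|]; first by have [o ->] := runs r.
rewrite expn1; case: (posnP n) => [->|n0]; first by rewrite muln0.
have [good [goodP few]] := good_keys_frequent valid n0 leT.
apply: leq_trans few; rewrite leq_mul2r; apply/orP; right.
apply: subset_leq_card; apply/subsetP => r; rewrite !inE.
have [o -> oE] := runs r; apply: contra => /goodP/oE ->; exact: eqxx.
Qed.
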